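(* Let $X$ and $Y$ be $C^\infty$ vector fields on $\mathbb{R}^2$ with $X(0)=Y(0)=0$, each globally asymptotically stable at the origin. Let $\mathcal{Z}=\{p\in\mathbb{R}^2 : \det(X(p),Y(p))=0\}$. Assume that $\mathcal{Z}=\{0\}$. Then the switched system $$\dot q=u\,X(q)+(1-u)\,Y(q),\qquad q\in\mathbb{R}^2,\ u\in[0,1],$$ is globally uniformly asymptotically stable (GUAS) at the origin.
   Context: Switching functions are arbitrary measurable functions $u:[0,\infty)\to[0,1]$; let $\mathcal{U}$ be the set of all of them. For $p\in\mathbb{R}^2$ and $u\in\mathcal{U}$, let $t\mapsto\gamma(p,u,t)$ be the maximal solution of $\dot q(t)=u(t)X(q(t))+(1-u(t))Y(q(t))$ with $\gamma(p,u,0)=p$, defined on $[0,\mathcal{T}(p,u))$ with $\mathcal{T}(p,u)\in(0,+\infty]$. The accessible set from $p$ is $\mathcal{A}(p)=\bigcup_{u\in\mathcal{U}}\gamma(p,u,[0,\mathcal{T}(p,u)))$. $B_\delta$ denotes the ball of radius $\delta$ centered at the origin. The system is uniformly stable at the origin if for every $\delta>0$ there exists $\varepsilon>0$ such that $\mathcal{A}(p)\subset B_\delta$ for every $p\in B_\varepsilon$. It is globally uniformly attractive at the origin if for every $\delta_1,\delta_2>0$ there exists $T>0$ such that $\gamma(p,u,T)\in B_{\delta_1}$ for every $u\in\mathcal{U}$ and every $p\in B_{\delta_2}$. It is GUAS at the origin if it is uniformly stable and globally uniformly attractive at the origin. A vector field is globally asymptotically stable at the origin if the origin is a Lyapunov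 stable equilibrium and all its integral curves converge to the origin as $t\to+\infty$. *)

(* Defs.v *)
From HB Require Import structures.
From mathcomp Require Import all_boot all_order all_algebra.
From mathcomp Require Import all_classical all_reals all_analysis.

Set Implicit Arguments.
Unset Strict Implicit.
Unset Printing Implicit Defensive.
Import Order.TTheory GRing.Theory Num.Theory.
Import numFieldNormedType.Exports.
Local Open Scope classical_set_scope.
Local Open Scope ring_scope.

(* The norm of the library on ['rV[R]_2] is the sup norm, hence this explicit
   Euclidean ball. *)
Definition eball (R : realType) (d : R) : set 'rV[R]_2 :=
  [set p | Num.sqrt (\sum_i p 0 i ^+ 2) < d].

(* Class C^n: all partial derivatives of order at most n exist and are
   continuous. *)
Fixpoint class_C (R : realType) (n : nat) (f : 'rV[R]_2 -> 'rV[R]_2) : Prop :=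
  continuous f /\
  match n with
  | 0 => True
  | m.+1 => forall i : 'I_2,
      (forall p, derivable f p 'e_i) /\ class_C m ('D_'e_i f)
  end.

Definition smooth (R : realType) (f : 'rV[R]_2 -> 'rV[R]_2) : Prop :=
  forall n, class_C n f.

Definition collinearity_set (R : realType) (X Y : 'rV[R]_2 -> 'rV[R]_2) :
    set 'rV[R]_2 :=
  [set p | \det (col_mx (X p) (Y p) : 'M[R]_2) = 0].

(* The interval [0, T), with T possibly infinite. *)
Definition horizon (R : realType) (T : \bar R) : set R :=
  [set t | 0 <= t /\ (t%:E < T)%E].

(* [S T q] reads "the restriction of q to [0, T) is a solution"; the values of
   q outside [0, T) are irrelevant. The solution is maximal when no solution
   extends it to a strictly larger interval. *)
Definition maximal (R : realType) (S : \bar R -> (R -> 'rV[R]_2) -> Prop)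
    (T : \bar R) (q : R -> 'rV[R]_2) : Prop :=
  S T q /\
  forall T' q', S T' q' -> (forall t, horizon T t -> q' t = q t) -> (T' <= T)%E.

(* At t = 0 only continuity is required: since X is continuous, the equation
   then holds there too, for the right derivative. *)
Definition integral_curve (R : realType) (X : 'rV[R]_2 -> 'rV[R]_2)
    (p : 'rV[R]_2) (T : \bar R) (q : R -> 'rV[R]_2) : Prop :=
  [/\ (0 < T)%E, q 0 = p, {within horizon T, continuous q} &
      forall t : R, 0 < t -> (t%:E < T)%E -> is_derive t (1 : R) q (X (q t))].

Definition lyapunov_stable (R : realType) (X : 'rV[R]_2 -> 'rV[R]_2) : Prop :=
  forall e : R, 0 < e -> exists2 d : R, 0 < d &
    forall p T q, eball d p -> integral_curve X p T q ->
      forall t, horizon T t -> eball e (q t).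

Definition vf_globally_asymptotically_stable (R : realType)
    (X : 'rV[R]_2 -> 'rV[R]_2) : Prop :=
  [/\ X 0 = 0, lyapunov_stable X &
      forall p T q, maximal (integral_curve X p) T q ->
        T = +oo%E /\ q t @[t --> +oo] --> (0 : 'rV[R]_2)].

(* R equipped with the sigma-algebra of Lebesgue measurable sets (the domain
   of [completed_lebesgue_measure]), rather than the Borel one. *)
Notation lebesgueR R := (caratheodory_type (@wlength R idfun)^*%mu).

Definition switching (R : realType) : set (R -> R) :=
  [set u | @measurable_fun _ _ (lebesgueR R) (measurableTypeR R) `[0, +oo[ u /\
           forall t : R, 0 <= t -> 0 <= u t <= 1].

(* Solutions in the sense of Caratheodory: u being only measurable, the
   equation is understood in integral form, coordinate by coordinate. *)
Definition switched_solution (R : realType) (X Y : 'rV[R]_2 -> 'rV[R]_2)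
    (p : 'rV[R]_2) (u : R -> R) (T : \bar R) (q : R -> 'rV[R]_2) : Prop :=
  [/\ (0 < T)%E, {within horizon T, continuous q} &
      forall t, horizon T t -> forall i,
        q t 0 i = p 0 i +
          \int[@completed_lebesgue_measure R]_(s in `[0, t])
            (u s *: X (q s) + (1 - u s) *: Y (q s)) 0 i].

(* The maximal solution, as the pair of its life span and the curve. The
   default, of empty domain, is used only if there is no maximal solution. *)
Definition max_solution (R : realType) (X Y : 'rV[R]_2 -> 'rV[R]_2)
    (p : 'rV[R]_2) (u : R -> R) : \bar R * (R -> 'rV[R]_2) :=
  xget (0%E, fun=> 0)
    [set Tq | maximal (switched_solution X Y p u) Tq.1 Tq.2].

Definition life_span (R : realType) (X Y : 'rV[R]_2 -> 'rV[R]_2)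
    (p : 'rV[R]_2) (u : R -> R) : \bar R := (max_solution X Y p u).1.

Definition gamma (R : realType) (X Y : 'rV[R]_2 -> 'rV[R]_2)
    (p : 'rV[R]_2) (u : R -> R) (t : R) : 'rV[R]_2 := (max_solution X Y p u).2 t.

Definition accessible (R : realType) (X Y : 'rV[R]_2 -> 'rV[R]_2)
    (p : 'rV[R]_2) : set 'rV[R]_2 :=
  \bigcup_(u in @switching R) (gamma X Y p u @` horizon (life_span X Y p u)).

Definition uniformly_stable (R : realType) (X Y : 'rV[R]_2 -> 'rV[R]_2) :
    Prop :=
  forall d : R, 0 < d -> exists2 e : R, 0 < e &
    forall p, eball e p -> accessible X Y p `<=` eball d.

(* [gamma X Y p u T] is meaningful only for T below the life span. *)
Definition globally_uniformly_attractive (R : realType)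
    (X Y : 'rV[R]_2 -> 'rV[R]_2) : Prop :=
  forall d1 d2 : R, 0 < d1 -> 0 < d2 -> exists2 T : R, 0 < T &
    forall u p, switching u -> eball d2 p ->
      (T%:E < life_span X Y p u)%E /\ eball d1 (gamma X Y p u T).

Definition GUAS (R : realType) (X Y : 'rV[R]_2 -> 'rV[R]_2) : Prop :=
  uniformly_stable X Y /\ globally_uniformly_attractive X Y.

(* Main.v *)
Require Import Defs.
From mathcomp Require Import all_boot all_order all_algebra.
From mathcomp Require Import all_classical all_reals all_analysis.
From mathcomp Require Import measurable_realfun.
From mathcomp Require Import ring lra.
Set Implicit Arguments.
Unset Strict Implicit.
Unset Printing Implicit Defensive.
Import Order.TTheory GRing.Theory Num.Theory.
Import numFieldNormedType.Exports.
Local Open Scope classical_set_scope.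
Local Open Scope ring_scope.

(** Let phi and psi be the forward flows of X and Y. Every trajectory of the
    switched system from p runs through points phi s (psi k p) with s and k
    nonnegative. As both flows are stable, the boundedness of trajectories and the
    uniform stability of the switched system follow at once.

    Here is why. Off the origin X and Y form a basis, so the bracket
    DY X - DX Y equals m X + n Y for continuous functions m and n. Along an orbit
    y(t) = phi t x let c and A solve c' = - n c, c(0) = 1 and A' = m c, A(0) = 0.
    Then the differential of phi t maps Y(x) to c(t) Y(y(t)) - A(t) X(y(t)), since
    both solve the equation linearised along y (orbit_variation). The
    exponential c is positive. In the coordinates (s, k) of phi s (psi k p), the
    velocity l X + (1 - l) Y with l in [0, 1] therefore reads
    s' = l + (1 - l) A / c and k' = (1 - l) / c. So k does not decrease, and s
    does not become negative because A is 0 at s = 0 (tangent_step).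

    As long as phi s (psi k p) is away from the origin, the uniform attractivity of
    phi and psi on bounded sets bounds s and k, hence also A, c and 1 / c; then
    s + N k grows at rate at least 1 for some constant N. So a trajectory spends a
    bounded time away from the origin, which together with uniform stability gives
    uniform attractivity (tracking, switched_attractive). The points
    phi s (psi k p) are attached to a trajectory by an Euler scheme whose one-step
    error is quadratic (tracking).

    A measurable switching law u acts only through the time U(t) = int_0^t u spent
    in the first mode: trajectories are the continuous curves with
    q(t + h) - q(t) = (U(t + h) - U(t)) X(q(t)) + (h - (U(t + h) - U(t))) Y(q(t))
    up to o(h) as h tends to 0 from the right, at every interior time t (solves).
    All differential inequalities then follow from the monotonicity of
    continuous functions with nonpositive upper right derivative
    (nonincreasing_dini), and they apply to a trajectory restarted at a later
    time. Existence comes from Picard iteration for the fields projected on a box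
    (picard_fixpoint, switched_global_solution). *)

(** * Integrals weighted by a switching law *)

Section Caratheodory_integral.
Variable R : realType.
Notation mu := (@completed_lebesgue_measure R).
Implicit Types (t T a b e : R) (f g w : R -> R).

Lemma cara_itv (i : interval R) : @measurable _ (lebesgueR R) [set` i].
Proof. by apply: sub_caratheodory; exact: measurable_itv. Qed.

Lemma completed_itvoc t t' : t <= t' -> mu `]t, t'] = (t' - t)%:E.
Proof.
move=> tt'; transitivity (@lebesgue_measure R `]t, t']); first by [].
rewrite lebesgue_measure_itv/= lte_fin; case: ltP => [//|t't].
by rewrite (le_anti (_ : t <= t' <= t)) ?tt'// subrr.
Qed.

Lemma measurable_fun_cara (i : interval R) f :
  {within [set` i], continuous f} ->
  @measurable_fun _ _ (lebesgueR R) (measurableTypeR R) [set` i] f.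
Proof.
move=> cf _ B mB; apply: sub_caratheodory.
by apply: subspace_continuous_measurable_fun.
Qed.

Variable u : R -> R.
Hypothesis su : switching u.

Let measurable_u (i : interval R) : [set` i] `<=` `[0, +oo[ ->
  @measurable_fun _ _ (lebesgueR R) (measurableTypeR R) [set` i] u.
Proof.
move=> i0; have [mu' _] := su.
by apply: measurable_funS mu' => //; exact: cara_itv.
Qed.

Definition mix f g : R -> R := fun s => u s * f s + (1 - u s) * g s.

Lemma mixB f g a b s : mix (fun s => f s - a) (fun s => g s - b) s =
  mix f g s - (a * u s + b * (1 - u s)).
Proof. rewrite /mix; ring. Qed.

Lemma normr_mix_le f g e s : 0 <= s -> `|f s| <= e -> `|g s| <= e ->
  `|mix f g s| <= e.
Proof.
have [_ u01] := su => /u01/andP[u0 u1].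
rewrite /mix !ler_norml => /andP[f0 f1] /andP[g0 g1]; apply/andP; split; nra.
Qed.

Lemma mix_integrable T f g : 0 <= T ->
  {within `[0, T], continuous f} -> {within `[0, T], continuous g} ->
  mu.-integrable `[0, T] (EFin \o mix f g).
Proof.
move=> T0 cf cg; apply: measurable_bounded_integrable.
- exact: cara_itv.
- have : @lebesgue_measure R `[0, T] \is a fin_num.
    by rewrite lebesgue_measure_itv/=; case: ifP.
  by rewrite ge0_fin_numE.
- have mu' : @measurable_fun _ _ (lebesgueR R) (measurableTypeR R) `[0, T] u.
    by apply: measurable_u; apply: subset_itvl; rewrite bnd_simp.
  have mf := measurable_fun_cara cf; have mg := measurable_fun_cara cg.
  exact: (measurable_funD (measurable_funM mu' mf)
    (measurable_funM (measurable_funB (measurable_cst _) mu') mg)).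
- have [M MP] : exists M, forall s, `[0, T]%classic s -> `|f s| <= M /\ `|g s| <= M.
    have bf : bounded_set (f @` `[0, T]).
      exact/compact_bounded/continuous_compact/segment_compact.
    have bg : bounded_set (g @` `[0, T]).
      exact/compact_bounded/continuous_compact/segment_compact.
    have [Mf [_ Mf']] := bf; have [Mg [_ Mg']] := bg.
    exists (Num.max Mf Mg + 1) => s s0T; split.
      apply: (Mf' (Num.max Mf Mg + 1)); last by exists s.
      by rewrite (le_lt_trans (_ : _ <= Num.max Mf Mg)) ?le_max ?lexx// ltrDl.
    apply: (Mg' (Num.max Mf Mg + 1)); last by exists s.
    by rewrite (le_lt_trans (_ : _ <= Num.max Mf Mg)) ?le_max ?lexx ?orbT// ltrDl.
  exists M; split; first exact: num_real.
  move=> N MN s /= s0T; have [fM gM] := MP _ s0T.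
  have s0 : 0 <= s by move: s0T; rewrite in_itv/= => /andP[].
  by apply: (le_trans (normr_mix_le s0 fM gM)); exact: ltW.
Qed.

Definition mix_int f g t : R := \int[mu]_(s in `[0, t]) mix f g s.

(** Time spent by the switching law on the first mode. *)
Definition mode_time t : R := mix_int (fun=> 1) (fun=> 0) t.

Lemma mix_int0 f g : mix_int f g 0 = 0.
Proof.
have m0 : @measurable _ (lebesgueR R) [set 0] by rewrite -set_itv1; exact: cara_itv.
have mf : @measurable_fun _ _ (lebesgueR R) _ [set 0] (EFin \o mix f g).
  move=> _ B _; have [B0|B0] := pselect (B (mix f g 0)%:E).
    rewrite (_ : _ `&` _ = [set 0])//.
    by apply/seteqP; split => [s []//|s /= ->].
  rewrite (_ : _ `&` _ = set0); first exact: measurable0.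
  by apply/seteqP; split => // s [/= -> /B0].
rewrite /mix_int set_itv1 /Rintegral (null_set_integral m0 mf) ?fine0//.
exact: (@lebesgue_measure_set1 R 0).
Qed.

Lemma mix_intB T f g t t' : 0 <= t -> t <= t' -> t' <= T ->
  {within `[0, T], continuous f} -> {within `[0, T], continuous g} ->
  mix_int f g t' - mix_int f g t = \int[mu]_(s in `]t, t']) mix f g s.
Proof.
move=> t0 tt' t'T cf cg; rewrite /mix_int.
have T0 : 0 <= T by lra.
have E : `[0, t']%classic = `[0, t]%classic `|` `]t, t']%classic :> set R.
  by rewrite -itv_bndbnd_setU// bnd_simp.
rewrite E Rintegral_setU.
- by rewrite addrC addrA addNr add0r.
- exact: cara_itv.
- exact: cara_itv.
- rewrite -E; apply: integrableS (mix_integrable T0 cf cg); try exact: cara_itv.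
  by apply: subset_itvl; rewrite bnd_simp.
- apply/disj_setPS => s [/=]; rewrite !in_itv/= => /andP[_ h1] /andP[h2 _].
  by move: (lt_le_trans h2 h1); rewrite ltxx.
Qed.

(** Freezing f and g at constants a and b takes them out of the integrals of
    u and of 1 - u. For a = b = 0 this is a Lipschitz bound. *)
Lemma mix_int_near T f g t t' a b e : 0 <= t -> t <= t' -> t' <= T ->
  {within `[0, T], continuous f} -> {within `[0, T], continuous g} ->
  (forall s, t <= s <= t' -> `|f s - a| <= e /\ `|g s - b| <= e) ->
  `|mix_int f g t' - mix_int f g t - a * (mode_time t' - mode_time t)
    - b * (t' - t - (mode_time t' - mode_time t))| <= e * (t' - t).
Proof.
move=> t0 tt' t'T cf cg fab.
have T0 : 0 <= T by lra.
have ccst (c : R) : {within `[0, T], continuous (fun _ : R => c)}.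
  by apply: continuous_subspaceT => ?; exact: cst_continuous.
have sub : `]t, t'] `<=` `[0, T].
  by move=> s /=; rewrite !in_itv/= => /andP[? ?]; apply/andP; split; lra.
have intS (h k : R -> R) : {within `[0, T], continuous h} ->
    {within `[0, T], continuous k} -> mu.-integrable `]t, t'] (EFin \o mix h k).
  by move=> ch ck; apply: integrableS (mix_integrable T0 ch ck) => //; exact: cara_itv.
have intC c : \int[mu]_(s in `]t, t']) mix (fun=> c) (fun=> c) s = c * (t' - t).
  rewrite (@eq_Rintegral _ _ _ mu _ (fun=> c)); last by move=> s _; rewrite /mix/=; ring.
  rewrite Rintegral_cst; last exact: cara_itv.
  by congr (_ * _); rewrite -[RHS]/(fine (t' - t)%:E); congr fine; exact: completed_itvoc.
rewrite /mode_time !(mix_intB t0 tt' t'T)//.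
set I := (X in X - _ - _); set J := (X in a * X).
have -> : I - a * J - b * (t' - t - J) =
    \int[mu]_(s in `]t, t']) mix (fun s => f s - a) (fun s => g s - b) s.
  rewrite (@eq_Rintegral _ _ _ mu _ (fun s => mix f g s - mix (fun=> a) (fun=> b) s)); last first.
    by move=> s _; rewrite mixB /mix/=; ring.
  have ab : \int[mu]_(s in `]t, t']) mix (fun=> a) (fun=> b) s = (a - b) * J + b * (t' - t).
    rewrite -(intC b) /J -RintegralZl; [|exact: cara_itv|exact: intS].
    rewrite -RintegralD; [|exact: cara_itv| |exact: intS]; last first.
      rewrite (_ : EFin \o _ = EFin \o mix (fun=> a - b) (fun=> 0)); first exact: intS.
      by apply/funext => s; rewrite /= /mix/=; congr EFin; ring.
    by apply: eq_Rintegral => s _; rewrite /mix/=; ring.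
  rewrite RintegralB; [|exact: cara_itv|exact: intS|exact: intS].
  rewrite ab -/I; ring.
have cB (h : R -> R) (c : R) : {within `[0, T], continuous h} ->
    {within `[0, T], continuous (fun s => h s - c)}.
  by move=> ch s; apply: continuousB; [exact: ch|exact: cst_continuous].
apply: le_trans (le_normr_Rintegral _ _) _; [exact: cara_itv|exact/intS/cB/cg/cB|].
rewrite -intC; apply: le_Rintegral; [exact: cara_itv| |exact: intS|].
- have := integrable_norm (intS _ _ (cB _ a cf) (cB _ b cg)).
  exact.
- move=> s /=; rewrite in_itv/= => /andP[ts st'].
  have [fa gb] := fab s ltac:(by rewrite (ltW ts)).
  rewrite {2}/mix (_ : _ + _ = e); last by rewrite /cst; ring.
  by apply: normr_mix_le => //; lra.
Qed.

Lemma mode_time_incr t t' : 0 <= t -> t <= t' ->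
  0 <= mode_time t' - mode_time t <= t' - t.
Proof.
move=> t0 tt'; have ccst (c : R) : {within `[0, t'], continuous (fun _ : R => c)}.
  by apply: continuous_subspaceT => ?; exact: cst_continuous.
have := @mix_int_near t' (fun=> 1) (fun=> 0) t t' 2^-1 2^-1 2^-1 t0 tt' (lexx _) (ccst _) (ccst _).
rewrite -/(mode_time _) -/(mode_time _); set D := _ - mode_time t => h.
(* The constants 1 and 0 are both at distance 1/2 from 1/2. *)
have : `|D - 2^-1 * D - 2^-1 * (t' - t - D)| <= 2^-1 * (t' - t).
  apply: h => s _; rewrite /cst; split.
    by rewrite ger0_norm; lra.
  by rewrite ler0_norm; lra.
by rewrite ler_norml => /andP[? ?]; apply/andP; split; lra.
Qed.
End Caratheodory_integral.

(** * Right-sided monotonicity criteria on an interval *)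

Section Real_induction.
Variable R : realType.
Implicit Types a b t s d e h L K T : R.

(** The times t such that P holds on [a, t] have a supremum; P holds there by
    the last condition, and the one before forbids it to be less than b. *)
Lemma real_induction (P : R -> Prop) a b : P a ->
  (forall t, a <= t < b -> (forall s, a <= s <= t -> P s) ->
    exists2 d, 0 < d & forall s, t < s < t + d -> s <= b -> P s) ->
  (forall t, a < t <= b -> (forall s, a <= s < t -> P s) -> P t) ->
  forall t, a <= t <= b -> P t.
Proof.
move=> Pa step closed.
pose S := [set t | a <= t <= b /\ forall s, a <= s <= t -> P s].
move=> t0 /andP[at0 t0b]; have ab := le_trans at0 t0b.
have Sa : S a.
  split; first by rewrite lexx.
  by move=> s; rewrite -eq_le => /eqP <-.
have bS : has_ubound S by exists b => t [] /andP[].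
have hS : has_sup S by split => //; exists a.
pose c := sup S.
have ac : a <= c by apply: ub_le_sup.
have cb : c <= b by apply: ge_sup; [exists a|move=> t [] /andP[]].
have below s : a <= s < c -> P s.
  move=> /andP[as_ sc]; have [t [_ tP] st] := sup_gt (ex_intro _ _ Sa) sc.
  by apply: tP; rewrite as_ ltW.
have Pc : P c.
  have [<-//|ac'] := eqVneq a c; apply: closed => //.
  by rewrite lt_neqAle ac' ac.
have Pcle s : a <= s <= c -> P s.
  move=> /andP[as_]; rewrite le_eqVlt => /predU1P[->//|sc].
  by apply: below; rewrite as_.
have [cb'|bc] := ltP c b; last by apply: Pcle; rewrite at0 (le_trans t0b bc).
have [d d0 dP] := step c ltac:(by rewrite ac) Pcle.
pose c' := Num.min b (c + d / 2).
have cc' : c < c' by rewrite lt_min cb' ltrDl divr_gt0.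
suff : c' <= c by rewrite leNgt cc'.
apply: ub_le_sup => //; split.
  by rewrite (le_trans ac (ltW cc')) ge_min lexx.
move=> s /andP[as_ sc']; have [sc|cs] := leP s c; first by apply: Pcle; rewrite as_.
have := sc'; rewrite le_min => /andP[sb sd]; apply: dP => //; rewrite cs/=; lra.
Qed.

Lemma nbhs_rightP (P : R -> Prop) :
  (\forall h \near 0^'+, P h) <-> exists2 d, 0 < d & forall h, 0 < h < d -> P h.
Proof.
split.
  move=> [d /= d0 dP]; exists d => // h /andP[h0 hd]; apply: dP => //=.
  by rewrite sub0r normrN gtr0_norm.
move=> [d d0 dP]; exists d => //= h /=; rewrite sub0r normrN => hd h0.
by apply: dP; rewrite h0 -(gtr0_norm h0).
Qed.

Lemma within_cont_distP (V : normedModType R) (A : set R) (f : R -> V) :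
  {within A, continuous f} <->
  forall t, A t -> forall e, 0 < e -> exists2 d, 0 < d &
    forall s, A s -> `|s - t| < d -> `|f s - f t| < e.
Proof.
rewrite subspace_continuousP; split.
  move=> cf t At e e0; have /cvgrPdist_lt /(_ e e0) [d /= d0 dP] := cf t At.
  by exists d => // s As st; rewrite distrC; apply: dP => //=; rewrite distrC.
move=> H t At; apply/cvgrPdist_lt => e e0.
have [d d0 dP] := H t At e e0.
by exists d => //= s /= st As; rewrite distrC; apply: dP => //; rewrite distrC.
Qed.

Lemma within_continuousP (V : normedModType R) (f : R -> V) a b :
  {within `[a, b], continuous f} <->
  forall t, a <= t <= b -> forall e, 0 < e -> exists2 d, 0 < d &
    forall s, a <= s <= b -> `|s - t| < d -> `|f s - f t| < e.
Proof.
rewrite within_cont_distP; split=> H t; have := H t; rewrite /= in_itv/= => /[apply].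
  by move=> {}H e /H[d d0 dP]; exists d => // s sab; apply: dP; rewrite /= in_itv.
by move=> {}H e /H[d d0 dP]; exists d => // s; rewrite /= in_itv; exact: dP.
Qed.

(** Real induction on f t <= f 0 + e * (1 + t): continuity takes care of a
    neighbourhood of 0, where the slack e is available, and the condition on
    the right increments of what follows. *)
Lemma nonincreasing_dini (f : R -> R) T : 0 <= T -> {within `[0, T], continuous f} ->
  (forall t, 0 < t < T -> forall e, 0 < e -> \forall h \near 0^'+, f (t + h) <= f t + e * h) ->
  f T <= f 0.
Proof.
move=> T0 /within_continuousP cf df.
suff fe e : 0 < e -> f T <= f 0 + e * (1 + T).
  apply/ler_addgt0Pr => e e0.
  have := fe (e / (1 + T)) ltac:(rewrite divr_gt0//; lra).
  by rewrite divfK// gt_eqF//; lra.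
move=> e0; have := @real_induction (fun t => f t <= f 0 + e * (1 + t)) 0 T.
apply; last by rewrite T0 lexx.
- by rewrite lerDl addr0 mulr1 ltW.
- move=> t /andP[]; rewrite le_eqVlt => /predU1P[<- T1 _|t0 tT /(_ t)].
    have [d d0 dP] := cf 0 ltac:(by rewrite lexx) e e0.
    exists d => // s /andP[s0 sd] sT.
    have := dP s ltac:(by rewrite sT ltW)
      ltac:(by rewrite subr0 gtr0_norm//; rewrite add0r in sd).
    by rewrite ltr_distl => /andP[_ h]; nra.
  rewrite lexx (ltW t0) => /(_ isT) ft.
  have /nbhs_rightP[d d0 dP] := df t ltac:(by rewrite t0) e e0.
  exists d => // s /andP[ts sd] sT.
  have := dP (s - t) ltac:(apply/andP; split; lra).
  by rewrite addrC subrK => h; nra.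
- move=> t /andP[t0 tT] ft; apply/ler_addgt0Pr => k k0.
  have [d d0 dP] := cf t ltac:(by rewrite tT ltW) k k0.
  pose s := Num.max 0 (t - d / 2).
  have s0 : 0 <= s by rewrite le_max lexx.
  have st : s < t by rewrite gt_max t0/=; lra.
  have sd : t - d < s by rewrite lt_max; apply/orP; right; lra.
  have := ft s ltac:(by rewrite s0 st).
  have := dP s ltac:(rewrite s0/=; lra) ltac:(rewrite ltr_distl; apply/andP; split; lra).
  rewrite ltr_distl => /andP[h _] h'; nra.
Qed.

(** A continuous quantity that stays below m as long as it is below m' > m
    cannot cross the gap between m and m'. *)
Lemma continuation (f : R -> R) T m m' : 0 <= T -> {within `[0, T], continuous f} ->
  m < m' -> f 0 <= m ->
  (forall t, 0 <= t <= T -> (forall s, 0 <= s <= t -> f s <= m') -> f t <= m) ->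
  forall t, 0 <= t <= T -> f t <= m.
Proof.
move=> T0 /within_continuousP cf mm' f0 H.
apply: real_induction => //.
- move=> t /andP[t0 tT] ft.
  have [d d0 dP] := cf t ltac:(by rewrite t0 ltW) (m' - m) ltac:(lra).
  exists d => // s /andP[ts sd] sT; apply: H; first by rewrite sT andbT; lra.
  move=> r /andP[r0 rs]; have [rt|tr] := leP r t.
    by apply: le_trans (ltW mm'); apply: ft; rewrite r0.
  have := dP r ltac:(rewrite r0/=; lra) ltac:(rewrite ltr_distl; apply/andP; split; lra).
  have := ft t ltac:(by rewrite t0 lexx).
  by rewrite ltr_distl => ? /andP[_ ?]; lra.
- move=> t /andP[t0 tT] ft; apply/ler_addgt0Pr => k k0.
  have [d d0 dP] := cf t ltac:(by rewrite tT ltW) k k0.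
  pose s := Num.max 0 (t - d / 2).
  have s0 : 0 <= s by rewrite le_max lexx.
  have st : s < t by rewrite gt_max t0/=; lra.
  have sd : t - d < s by rewrite lt_max; apply/orP; right; lra.
  have := ft s ltac:(by rewrite s0 st).
  have := dP s ltac:(rewrite s0/=; lra) ltac:(rewrite ltr_distl; apply/andP; split; lra).
  rewrite ltr_distl => /andP[h _] h'; lra.
Qed.
End Real_induction.

(** * Growth estimates *)

Section Growth.
Variables (R : realType) (V : normedModType R).
Implicit Types (t s d e h L K T : R) (f : R -> V).

Lemma continuous_within_norm f T :
  {within `[0, T], continuous f} -> {within `[0, T], continuous (fun t => `|f t|)}.
Proof.
by move=> cf t; apply: cvg_norm; exact: cf.
Qed.

(** `|f t - f 0| - g t has a nonpositive upper right derivative. *)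
Lemma mean_value_dini f (g : R -> R) T : 0 <= T ->
  {within `[0, T], continuous f} -> {within `[0, T], continuous g} ->
  (forall t, 0 < t < T -> forall e, 0 < e ->
    \forall h \near 0^'+, `|f (t + h) - f t| <= g (t + h) - g t + e * h) ->
  `|f T - f 0| <= g T - g 0.
Proof.
move=> T0 cf cg fg.
have := @nonincreasing_dini R (fun t => `|f t - f 0| - g t) T T0.
rewrite subrr normr0 => H; suff : `|f T - f 0| - g T <= 0 - g 0 by lra.
apply: H => [|t t0T e e0].
  move=> t; apply: cvgB; last exact: cg.
  have cf0 : {within `[0, T], continuous (fun t => f t - f 0)}.
    by move=> s; apply: cvgB; [exact: cf|exact: cvg_cst].
  exact: continuous_within_norm cf0 t.
apply: filterS (fg t t0T e e0) => h fgh.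
have := ler_normD (f (t + h) - f t) (f t - f 0).
by rewrite addrA subrK; lra.
Qed.

Lemma continuous_expRM c T : {within `[0, T], continuous (fun t : R => expR (c * t))}.
Proof.
apply: continuous_subspaceT => t.
apply: (@continuous_comp _ _ _ (fun t => c * t) expR); last exact: continuous_expR.
by apply: cvgM; [exact: cvg_cst|].
Qed.

(** Since 1 + x <= expR x, the function (`|f t| + K) * expR (- (L + 1) * t)
    is nonincreasing; the additional 1 in the exponent absorbs K. *)
Lemma gronwall f L K T : 0 <= L -> 0 <= K -> 0 <= T ->
  {within `[0, T], continuous f} ->
  (forall t, 0 < t < T -> forall e, 0 < e ->
    \forall h \near 0^'+, `|f (t + h) - f t| <= (L * `|f t| + K + e) * h) ->
  `|f T| <= (`|f 0| + K) * expR ((L + 1) * T).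
Proof.
move=> L0 K0 T0 cf fL.
have := @nonincreasing_dini R (fun t => (`|f t| + K) * expR (- (L + 1) * t)) T T0.
rewrite mulr0 expR0 mulr1 mulNr expRN => H.
suff : (`|f T| + K) / expR ((L + 1) * T) <= `|f 0| + K.
  by rewrite ler_pdivrMr ?expR_gt0// => ?; lra.
apply: H => [|t t0T e e0].
  move=> t; apply: cvgM; last exact: continuous_expRM.
  by apply: cvgD; [exact: continuous_within_norm|exact: cvg_cst].
have /andP[t0 tT] := t0T.
near=> h.
have h0 : 0 < h by near: h; exact: nbhs_right_gt.
have fh : `|f (t + h) - f t| <= (L * `|f t| + K + e) * h.
  by near: h; exact: fL.
have ft := normr_ge0 (f t).
have fth : `|f (t + h)| + K <= (`|f t| + K) * (1 + (L + 1) * h) + e * h.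
  have := ler_normD (f (t + h) - f t) (f t); rewrite subrK => ?.
  have : 0 <= L * K * h by rewrite !mulr_ge0// ltW.
  have : 0 <= `|f t| * h by rewrite mulr_ge0// ltW.
  nra.
have eh : 1 + (L + 1) * h <= expR ((L + 1) * h) by exact: expR_ge1Dx.
have e1 : expR (- (L + 1) * t) <= 1.
  by rewrite -[leRHS]expR0 ler_expR mulNr oppr_le0 mulr_ge0//; lra.
have e2 : 0 < expR (- (L + 1) * t) by exact: expR_gt0.
rewrite mulrDr expRD mulNr expRN [- (L + 1) * h]mulNr expRN -expRN -mulNr.
set E := expR (- (L + 1) * t) in e1 e2 *.
set D := expR ((L + 1) * h) in eh *.
have D1 : 1 <= D by apply: le_trans eh; rewrite lerDl mulr_ge0//; lra.
have Di : D^-1 <= 1 by rewrite invf_le1//; lra.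
have D0 : 0 < D^-1 by rewrite invr_gt0; lra.
have step1 : (`|f (t + h)| + K) * D^-1 <= `|f t| + K + e * h.
  rewrite ler_pdivrMr; last lra.
  have eD : e * h <= e * h * D by rewrite ler_peMr// mulr_ge0// ltW.
  have fD : (`|f t| + K) * (1 + (L + 1) * h) <= (`|f t| + K) * D.
    by apply: ler_wpM2l => //; lra.
  by apply: (le_trans fth); rewrite [leRHS]mulrDl; lra.
have := ler_wpM2r (ltW e2) step1.
have : e * h * E <= e * h by rewrite ler_piMr// mulr_ge0// ltW.
by lra.
Unshelve. all: end_near. Qed.

(** A curve with this growth cannot reach 0 in finite time. The factor 2 comes
    from expR (- (2 * L * h)) <= 1 - L * h, true for small h only. *)
Lemma gronwall_lower f L T : 0 < L -> 0 <= T ->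
  {within `[0, T], continuous f} ->
  (forall t, 0 < t < T -> forall e, 0 < e ->
    \forall h \near 0^'+, `|f (t + h) - f t| <= (L * `|f t| + e) * h) ->
  `|f 0| <= `|f T| * expR (2 * L * T).
Proof.
move=> L0 T0 cf fL.
have := @nonincreasing_dini R (fun t => - `|f t| * expR (2 * L * t)) T T0.
rewrite mulr0 expR0 mulr1 => H.
suff : - `|f T| * expR (2 * L * T) <= - `|f 0| by rewrite mulNr lerN2.
apply: H => [|t /andP[t0 tT] e e0].
  move=> t; apply: cvgM; last exact: continuous_expRM.
  by apply: cvgN; exact: continuous_within_norm.
set E := expR (2 * L * t); have E0 : 0 < E by exact: expR_gt0.
pose M := E * expR (2 * L).
have M0 : 0 < M by rewrite mulr_gt0 ?expR_gt0.
near=> h.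
have h0 : 0 < h by near: h; exact: nbhs_right_gt.
have h1 : h < 1 by near: h; exact: nbhs_right_lt.
have hL : h < (2 * L)^-1 by near: h; apply: nbhs_right_lt; rewrite invr_gt0; lra.
have fh : `|f (t + h) - f t| <= (L * `|f t| + e / M) * h.
  by near: h; apply: fL; rewrite ?t0// divr_gt0.
have ft := normr_ge0 (f t).
have fth : `|f t| * (1 - L * h) - e / M * h <= `|f (t + h)|.
  have := ler_normD (f t - f (t + h)) (f (t + h)); rewrite subrK distrC => ?.
  nra.
have Lh : 2 * L * h < 1 by rewrite mulrC -ltr_pdivlMr ?div1r//; lra.
have Lh0 : 0 < L * h by rewrite mulr_gt0.
have eh : 1 + 2 * L * h <= expR (2 * L * h) by exact: expR_ge1Dx.
rewrite mulrDr expRD -/E !mulNr.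
set D := expR (2 * L * h) in eh *.
have D0 : 0 < D by exact: expR_gt0.
have ED : E * D <= M.
  by rewrite ler_pM2l// ler_expR ler_piMr//; lra.
have step1 : `|f t| <= `|f t| * (1 - L * h) * D.
  rewrite -mulrA ler_peMr//; nra.
have step2 : (`|f t| * (1 - L * h) - e / M * h) * (E * D) <= `|f (t + h)| * (E * D).
  by apply: ler_wpM2r fth; rewrite mulr_ge0// ltW.
have step3 : e / M * h * (E * D) <= e * h.
  rewrite mulrAC ler_wpM2r ?(ltW h0)//.
  by rewrite mulrAC ler_pdivrMr// ler_wpM2l// ltW.
have step4 := ler_wpM2r (ltW E0) step1.
nra.
Unshelve. all: end_near. Qed.
End Growth.

(** * Solutions in differential form *)

Section Solutions.
Variable R : realType.
Notation V := 'rV[R]_2.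
Implicit Types (t s d e h L K T B c : R) (q : R -> V) (F G : V -> V) (U u : R -> R).

Lemma row_norm_le (x : V) c : 0 <= c -> (`|x| <= c) <-> (forall i, `|x 0 i| <= c).
Proof.
move=> c0; rewrite [`|x|]mx_normrE; split.
  move=> /bigmax_leP[_ xc] i; exact: (xc (0, i)).
by move=> xc; apply/bigmax_leP; split => // -[a i] _ /=; rewrite (ord1 a).
Qed.

Lemma coord_le_norm (x : V) i : `|x 0 i| <= `|x|.
Proof. by move: i; apply/row_norm_le. Qed.

(** What solutions keep of a switching law u: U is t |-> int_0^t u. *)
Definition clock U := forall t s, 0 <= t -> t <= s -> 0 <= U s - U t <= s - t.

(** Differential form of q' = u F(q) + (1 - u) G(q) for the clock
    U(t) = int_0^t u. It is required at every interior time, even when u is only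
    measurable, because the increments of U are kept as they are instead of
    being replaced by u(t) h. *)
Definition solves U F G T q := {within `[0, T], continuous q} /\
  forall t, 0 < t < T -> forall e, 0 < e -> \forall h \near 0^'+,
    `|q (t + h) - q t - (U (t + h) - U t) *: F (q t)
      - (h - (U (t + h) - U t)) *: G (q t)| <= e * h.

Lemma le_geometric (a b c : R) : (forall n, a <= b + c * (1 / 2) ^+ n) -> a <= b.
Proof.
move=> H; have c0 : 0 < `|c| + 1 by rewrite ltr_wpDl.
apply/ler_addgt0Pr => e e0.
have half : `|1 / 2 : R| < 1 by rewrite ger0_norm; lra.
have := cvg_expr half.
move=> /cvgrPdist_lt /(_ (e / (`|c| + 1)) (divr_gt0 e0 c0)) [n _ /(_ n (leqnn _))].
have p0 : 0 <= (1 / 2 : R) ^+ n by apply: exprn_ge0; lra.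
rewrite /= sub0r normrN ger0_norm//.
rewrite ltr_pdivlMr// => H1; apply: (le_trans (H n)); rewrite lerD2l.
apply: le_trans (ltW H1); rewrite mulrC ler_wpM2l//.
by rewrite (le_trans (ler_norm c))// lerDl.
Qed.

(** The intervals centered at x n, of radius 2 * c * (1 / 2) ^+ n, are nested. *)
Lemma geometric_limit (x : nat -> R) c :
  (forall n, `|x n.+1 - x n| <= c * (1 / 2) ^+ n) ->
  exists l, forall n, `|x n - l| <= 2 * c * (1 / 2) ^+ n.
Proof.
move=> H; pose y n := 2 * c * (1 / 2) ^+ n.
have yS n : y n = y n.+1 + c * (1 / 2) ^+ n by rewrite /y exprS; field.
have y0 n : 0 <= y n.
  have := le_trans (normr_ge0 _) (H n); rewrite /y; lra.
have mono n k : x n - y n <= x (n + k)%N - y (n + k)%N /\ x (n + k)%N + y (n + k)%N <= x n + y n.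
  elim: k => [|k [IH1 IH2]]; first by rewrite addn0.
  rewrite addnS; have := H (n + k)%N; have := yS (n + k)%N.
  by rewrite ler_norml => ? /andP[? ?]; split; lra.
have cross n m : x n - y n <= x m + y m.
  have [nm|mn] := leqP n m.
    by have [+ _] := mono n (m - n)%N; rewrite subnKC//; have := y0 m; lra.
  by have [_] := mono m (n - m)%N; rewrite subnKC 1?ltnW//; have := y0 n; lra.
pose S := range (fun n => x n - y n).
have ubS m : ubound S (x m + y m) by move=> _ [n _ <-]; exact: cross.
exists (sup S) => n; rewrite -/(y n) ler_distl; apply/andP; split.
  by have : sup S <= x n + y n; [apply: ge_sup => //; exists (x 0%N - y 0%N); exists 0%N|lra].
have : x n - y n <= sup S by apply: ub_le_sup; [exists (x 0%N + y 0%N)|exists n].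
lra.
Qed.

Lemma mode_time_clock u : switching u -> clock (mode_time u).
Proof. by move=> su t s t0 ts; exact: mode_time_incr. Qed.

Lemma within_continuous_coord q T i : {within `[0, T], continuous q} ->
  {within `[0, T], continuous (fun t => q t 0 i)}.
Proof.
move=> /within_continuousP cq; apply/within_continuousP => t tT e e0.
have [d d0 dP] := cq t tT e e0; exists d => // s sT st.
by apply: le_lt_trans (dP s sT st); have := coord_le_norm (q s - q t) i; rewrite !mxE.
Qed.

Lemma within_continuous_comp F q T : continuous F ->
  {within `[0, T], continuous q} -> {within `[0, T], continuous (F \o q)}.
Proof. by move=> cF cq t; exact: (cvg_comp _ _ (cq t) (cF (q t))). Qed.

Section Picard.
Variables (u : R -> R) (F G : V -> V).
Hypotheses (su : switching u) (cF : continuous F) (cG : continuous G).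
Let U := mode_time u.

Definition picard p q t : V :=
  p + \row_i mix_int u (fun s => F (q s) 0 i) (fun s => G (q s) 0 i) t.

Lemma picard0 p q : picard p q 0 = p.
Proof. by apply/rowP => i; rewrite !mxE mix_int0// addr0. Qed.

Lemma picard_near p q T (a b : V) t s e : 0 <= e -> 0 <= t -> t <= s -> s <= T ->
  {within `[0, T], continuous q} ->
  (forall r, t <= r <= s -> `|F (q r) - a| <= e /\ `|G (q r) - b| <= e) ->
  `|picard p q s - picard p q t - (U s - U t) *: a - (s - t - (U s - U t)) *: b| <=
  e * (s - t).
Proof.
move=> e0 t0 ts sT cq ab; apply/row_norm_le; first by rewrite mulr_ge0// subr_ge0.
move=> i; rewrite !mxE.
have := @mix_int_near R u su T (fun s => F (q s) 0 i) (fun s => G (q s) 0 i) t s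
  (a 0 i) (b 0 i) e t0 ts sT.
move=> /(_ (within_continuous_coord (within_continuous_comp cF cq))).
move=> /(_ (within_continuous_coord (within_continuous_comp cG cq))).
rewrite -/U => H.
rewrite (_ : _ - _ = mix_int u (fun s => F (q s) 0 i) (fun s => G (q s) 0 i) s -
  mix_int u (fun s => F (q s) 0 i) (fun s => G (q s) 0 i) t -
  a 0 i * (U s - U t) - b 0 i * (s - t - (U s - U t))); last by ring.
apply: H => r tr; have [Fa Gb] := ab r tr.
have := coord_le_norm (F (q r) - a) i; have := coord_le_norm (G (q r) - b) i.
by rewrite !mxE => /le_trans /(_ Gb) ? /le_trans /(_ Fa) ?.
Qed.

Lemma picard_solves p q T : 0 <= T -> {within `[0, T], continuous q} ->
  forall t, 0 <= t < T -> forall e, 0 < e -> \forall h \near 0^'+,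
    `|picard p q (t + h) - picard p q t - (U (t + h) - U t) *: F (q t)
      - (h - (U (t + h) - U t)) *: G (q t)| <= e * h.
Proof.
move=> T0 cq t /andP[t0 tT] e e0; have tTT : 0 <= t <= T by rewrite t0 ltW.
have /within_continuousP /(_ t tTT e e0)[d d0 dP] := within_continuous_comp cF cq.
have /within_continuousP /(_ t tTT e e0)[k k0 kP] := within_continuous_comp cG cq.
near=> h.
have h0 : 0 < h by near: h; exact: nbhs_right_gt.
have hd : h < d by near: h; exact: nbhs_right_lt.
have hk : h < k by near: h; exact: nbhs_right_lt.
have hT : h < T - t by near: h; apply: nbhs_right_lt; rewrite subr_gt0.
have := @picard_near p q T (F (q t)) (G (q t)) t (t + h) e (ltW e0) t0.
rewrite [t + h - t]addrAC subrr add0r; apply => //; try lra.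
move=> r /andP[tr rh]; have rtT : 0 <= r <= T by apply/andP; split; lra.
have rt : `|r - t| <= h by rewrite ger0_norm; lra.
by split; apply/ltW; [apply: dP|apply: kP] => //; lra.
Unshelve. all: end_near. Qed.
End Picard.

(** The fields are continuous along q, so freezing them on [t, t + h] changes the
    integral by o(h). *)
Lemma switched_solution_solves (X Y : V -> V) p u (Ts : \bar R) q T :
  continuous X -> continuous Y -> switching u -> switched_solution X Y p u Ts q ->
  0 <= T -> (T%:E < Ts)%E -> q 0 = p /\ solves (mode_time u) X Y T q.
Proof.
move=> cX cY su [T0 cq qint] T0' TTs.
have hT t : 0 <= t <= T -> horizon Ts t.
  by move=> /andP[t0 tT]; split => //; apply: le_lt_trans TTs; rewrite lee_fin.
have cqT : {within `[0, T], continuous q}.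
  by apply: continuous_subspaceW cq => t; rewrite /= in_itv/=; exact: hT.
have qE t : 0 <= t <= T -> q t = picard u X Y p q t.
  move=> tT; apply/rowP => i; rewrite (qint t (hT t tT)) !mxE; congr (_ + _).
  by rewrite /mix_int; apply: eq_Rintegral => s _; rewrite /mix !mxE.
split; first by rewrite qE ?lexx// picard0.
split => // t /andP[t0 tT] e e0.
have tT' : 0 <= t <= T by rewrite !ltW.
have t0T : 0 <= t < T by rewrite tT andbT ltW.
near=> h.
have h0 : 0 < h by near: h; exact: nbhs_right_gt.
have hT' : h < T - t by near: h; apply: nbhs_right_lt; rewrite subr_gt0.
rewrite [q (t + h)]qE; last by apply/andP; split; lra.
rewrite [X in _ - X - _ *: _ - _]qE//.
near: h; exact: (picard_solves su cX cY p T0' cqT t0T e0).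
Unshelve. all: end_near. Qed.
End Solutions.

(** * Global solutions of Lipschitz systems *)

Section Existence.
Variable R : realType.
Notation V := 'rV[R]_2.
Implicit Types (p : V) (t s d e h L K T B c : R) (q : R -> V) (F G : V -> V) (U u : R -> R).

Lemma norm_mix_le (W : normedModType R) (x y : W) a h c : 0 <= a <= h ->
  `|x| <= c -> `|y| <= c -> `|a *: x + (h - a) *: y| <= c * h.
Proof.
move=> /andP[a0 ah] xc yc; apply: le_trans (ler_normD _ _) _.
rewrite !normrZ (ger0_norm a0) ger0_norm ?subr_ge0//.
have := ler_wpM2l a0 xc; have := ler_wpM2l (_ : 0 <= h - a) yc.
by rewrite subr_ge0 => /(_ ah); lra.
Qed.

Lemma lipschitz_within (W : normedModType R) (q : R -> W) B T : 0 <= B ->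
  (forall t s, 0 <= t -> t <= s -> s <= T -> `|q s - q t| <= B * (s - t)) ->
  {within `[0, T], continuous q}.
Proof.
move=> B0 qB; apply/within_continuousP => t /andP[t0 tT] e e0.
have B1 : 0 < B + 1 by rewrite ltr_wpDl.
exists (e / (B + 1)); first by rewrite divr_gt0.
move=> s /andP[s0 sT]; rewrite ltr_pdivlMr// => st.
apply: le_lt_trans st; apply: (@le_trans _ _ (B * `|s - t|)); last first.
  by rewrite mulrC ler_wpM2l// lerDl.
have [ts|/ltW ts] := leP t s; first by rewrite (ger0_norm (_ : 0 <= s - t)) ?subr_ge0// qB.
by rewrite distrC (distrC s) (ger0_norm (_ : 0 <= t - s)) ?subr_ge0// qB.
Qed.

Lemma lipschitz_continuous (W W' : normedModType R) (f : W -> W') L : 0 <= L ->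
  (forall x y, `|f x - f y| <= L * `|x - y|) -> continuous f.
Proof.
move=> L0 H x; apply/cvgrPdist_lt => e e0; have L1 : 0 < L + 1 by rewrite ltr_wpDl.
near=> y; apply: le_lt_trans (H x y) _.
apply: (@le_lt_trans _ _ ((L + 1) * `|x - y|)); first by rewrite ler_wpM2r// lerDl.
rewrite mulrC -ltr_pdivlMr//; near: y.
by apply: cvgr_dist_lt => //; rewrite divr_gt0.
Unshelve. all: end_near. Qed.

Section Global.
Variables (u : R -> R) (F G : V -> V) (L B : R).
Hypotheses (su : switching u) (L0 : 1 <= L).
Hypotheses (FL : forall x y, `|F x - F y| <= L * `|x - y|)
           (GL : forall x y, `|G x - G y| <= L * `|x - y|)
           (FB : forall x, `|F x| <= B) (GB : forall x, `|G x| <= B).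
Let U := mode_time u.

Let cF : continuous F := lipschitz_continuous (le_trans ler01 L0) FL.
Let cG : continuous G := lipschitz_continuous (le_trans ler01 L0) GL.
Let B0 : 0 <= B := le_trans (normr_ge0 _) (FB 0).

Lemma picard_lipschitz p q T t s : {within `[0, T], continuous q} ->
  0 <= t -> t <= s -> s <= T ->
  `|picard u F G p q s - picard u F G p q t| <= B * (s - t).
Proof.
move=> cq t0 ts sT.
have := @picard_near R u F G su cF cG p q T 0 0 t s B B0 t0 ts sT cq.
by rewrite !scaler0 !subr0; apply => r _; rewrite !subr0.
Qed.

(** The weight expR (2 * L * t) makes the Picard operator a contraction on the
    whole half-line. *)
Lemma picard_contraction p q1 q2 K T : 0 <= T -> 0 <= K ->
  {within `[0, T], continuous q1} -> {within `[0, T], continuous q2} ->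
  (forall t, 0 <= t <= T -> `|q1 t - q2 t| <= K * expR (2 * L * t)) ->
  `|picard u F G p q1 T - picard u F G p q2 T| <= K / 2 * expR (2 * L * T).
Proof.
move=> T0 K0 c1 c2 q12; have L1 := L0.
have cP q : {within `[0, T], continuous q} -> {within `[0, T], continuous (picard u F G p q)}.
  by move=> cq; apply: (lipschitz_within B0) => t s t0 ts sT; exact: picard_lipschitz cq _ _ _.
pose f t := picard u F G p q1 t - picard u F G p q2 t.
pose g t := K / 2 * expR (2 * L * t).
have f0 : f 0 = 0 by rewrite /f !picard0 subrr.
have fT : f T - f 0 = f T by exact: etrans (congr1 (fun z => f T - z) f0) (subr0 _).
suff bound : `|f T - f 0| <= g T - g 0.
  apply: (@le_trans _ _ (g T - g 0)); first by move: bound; rewrite fT.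
  by rewrite /g mulr0 expR0 mulr1 gerBl divr_ge0.
apply: mean_value_dini => // [t|t|t /andP[t0 tT] e e0].
- by apply: cvgB; exact: cP.
- by apply: cvgM; [exact: cvg_cst|exact: continuous_expRM].
have t0T : 0 <= t < T by rewrite tT ltW.
have e2 : 0 < e / 2 by rewrite divr_gt0.
apply: filterS3 (nbhs_right_gt 0) (picard_solves su cF cG p T0 c1 t0T e2)
  (picard_solves su cF cG p T0 c2 t0T e2) => h h0 H1 H2.
rewrite /f /g; set E := expR (2 * L * t).
have UU : 0 <= U (t + h) - U t <= h.
  by have := @mode_time_clock R u su t (t + h) (ltW t0);
    rewrite addrAC subrr add0r lerDl (ltW h0); apply.
have q12t : `|q1 t - q2 t| <= K * E by apply: q12; rewrite !ltW.
have FG : `|(U (t + h) - U t) *: (F (q1 t) - F (q2 t)) +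
    (h - (U (t + h) - U t)) *: (G (q1 t) - G (q2 t))| <= (L * (K * E)) * h.
  apply: norm_mix_le => //.
    by apply: le_trans (FL _ _) _; rewrite ler_wpM2l//; lra.
  by apply: le_trans (GL _ _) _; rewrite ler_wpM2l//; lra.
have gh : K / 2 * expR (2 * L * (t + h)) - K / 2 * E >= L * (K * E) * h.
  rewrite mulrDr expRD -/E.
  have := expR_ge1Dx (2 * L * h).
  have : 0 <= K / 2 * E by rewrite mulr_ge0 ?divr_ge0// ltW ?expR_gt0.
  move=> k1 k2; have := ler_wpM2l k1 k2; lra.
set A1 := _ - _ *: G (q1 t) in H1; set A2 := _ - _ *: G (q2 t) in H2.
set A3 := (X in `|X| <= L * _ * h) in FG.
have -> : picard u F G p q1 (t + h) - picard u F G p q2 (t + h) -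
    (picard u F G p q1 t - picard u F G p q2 t) = A1 - A2 + A3.
  rewrite /A1 /A2 /A3 -/U !scalerBr; apply/rowP => i; rewrite !mxE; ring.
have := ler_normD (A1 - A2) A3; have := ler_normB A1 A2; lra.
Qed.

(** The Picard iterates converge geometrically, with a common Lipschitz constant
    B in time, which gives the continuity of the limit. *)
Lemma picard_fixpoint p : exists q,
  (forall t, 0 <= t -> q t = picard u F G p q t) /\
  forall T, {within `[0, T], continuous q}.
Proof.
have arith a c : 2 * B * (1 / 2 * a) * c + 2 * B * a / 2 * c <= 2 * B * c * a by lra.
have L1 := L0; pose x n := iter n (picard u F G p) (fun=> p).
have cx n T : {within `[0, T], continuous (x n)}.
  elim: n => [|n IH]; first by move=> t; exact: cvg_cst.
  by apply: (lipschitz_within B0) => t s t0 ts sT; exact: picard_lipschitz IH _ _ _.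
have xS n t : 0 <= t -> `|x n.+1 t - x n t| <= B * (1 / 2) ^+ n * expR (2 * L * t).
  elim: n t => [|n IH] t t0.
    rewrite expr0 mulr1 /=.
    have := picard_lipschitz p (cx 0 t) (lexx 0) t0 (lexx t).
    rewrite picard0 subr0 => /le_trans; apply; rewrite ler_wpM2l//.
    have := expR_ge1Dx (2 * L * t); nra.
  have := @picard_contraction p (x n.+1) (x n) (B * (1 / 2) ^+ n) t t0.
  rewrite exprS (_ : B * (1 / 2 * _) = B * (1 / 2) ^+ n / 2); last by field.
  apply; [|exact: cx|exact: cx|by move=> s /andP[s0 _]; exact: IH].
  by rewrite mulr_ge0// exprn_ge0//; lra.
have [q qP] : exists q, forall n t, 0 <= t ->
    `|x n t - q t| <= 2 * B * (1 / 2) ^+ n * expR (2 * L * t).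
  have /choice [q qP] t : exists l : V, 0 <= t -> forall n,
      `|x n t - l| <= 2 * B * (1 / 2) ^+ n * expR (2 * L * t).
    have [t0|t0] := leP 0 t; last by exists 0.
    have /choice [l lP] i : exists l, forall n, `|x n t 0 i - l| <=
        2 * (B * expR (2 * L * t)) * (1 / 2) ^+ n.
      apply: geometric_limit => n; have := xS n t t0.
      have := coord_le_norm (x n.+1 t - x n t) i; rewrite !mxE => /le_trans /[apply].
      by rewrite mulrAC.
    exists (\row_i l i) => _ n; apply/row_norm_le.
      by rewrite !mulr_ge0// ?ltW ?expR_gt0// exprn_ge0//; lra.
    by move=> i; rewrite !mxE; apply: le_trans (lP i n) _; lra.
  by exists q => n t t0; exact: qP.
have cq T : {within `[0, T], continuous q}.
  apply: (lipschitz_within B0) => t s t0 ts sT.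
  apply: (@le_geometric _ _ _ (2 * B * expR (2 * L * s) + 2 * B * expR (2 * L * t))) => n.
  have h1 := qP n.+1 t t0; have h2 := qP n.+1 s (le_trans t0 ts).
  have h3 := picard_lipschitz p (cx n T) t0 ts sT.
  rewrite -/(x n.+1 s) -/(x n.+1 t) in h3.
  have -> : q s - q t = (x n.+1 s - x n.+1 t) - (x n.+1 s - q s) + (x n.+1 t - q t).
    by apply/rowP => i; rewrite !mxE; ring.
  have := ler_normD ((x n.+1 s - x n.+1 t) - (x n.+1 s - q s)) (x n.+1 t - q t).
  have := ler_normB (x n.+1 s - x n.+1 t) (x n.+1 s - q s).
  have k1 : 0 <= B * (1 / 2) ^+ n * expR (2 * L * s).
    by rewrite !mulr_ge0// ?ltW ?expR_gt0// exprn_ge0//; lra.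
  have k2 : 0 <= B * (1 / 2) ^+ n * expR (2 * L * t).
    by rewrite !mulr_ge0// ?ltW ?expR_gt0// exprn_ge0//; lra.
  rewrite exprS in h1 h2; lra.
exists q; split => // t t0; apply/eqP; rewrite -subr_eq0 -normr_le0; apply/eqP.
apply/eqP; apply: (@le_geometric _ _ _ (2 * B * expR (2 * L * t))) => n; rewrite add0r.
have h1 := qP n.+1 t t0.
have h2 : `|x n.+1 t - picard u F G p q t| <= 2 * B * (1 / 2) ^+ n / 2 * expR (2 * L * t).
  apply: picard_contraction => //; last by move=> s /andP[s0 _]; exact: qP.
  by rewrite !mulr_ge0// exprn_ge0//; lra.
have h3 := ler_distD (x n.+1 t) (q t) (picard u F G p q t).
rewrite exprS distrC in h1.
exact: le_trans h3 (le_trans (lerD h1 h2) (arith _ _)).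
Qed.
End Global.
End Existence.

(** * Dependence of solutions on initial data *)

Section Solves_theory.
Variable R : realType.
Notation V := 'rV[R]_2.
Implicit Types (p x y : V) (t s d e h L K T B M c r : R).
Implicit Types (q : R -> V) (F G X Y : V -> V) (U u : R -> R).

Definition locally_lipschitz F := forall M, exists2 L, 1 <= L &
  forall x y, `|x| <= M -> `|y| <= M -> `|F x - F y| <= L * `|x - y|.

Lemma clock_step U t h : clock U -> 0 <= t -> 0 <= h -> 0 <= U (t + h) - U t <= h.
Proof.
by move=> cU t0 h0; have := cU t (t + h) t0; rewrite lerDl addrAC subrr add0r; apply.
Qed.

Lemma clock_id : clock (@id R).
Proof. by move=> t s t0 ts; rewrite subr_ge0 ts lexx. Qed.

Lemma clock_shift U r : 0 <= r -> clock U -> clock (fun t => U (r + t)).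
Proof.
move=> r0 cU t s t0 ts; have := cU (r + t) (r + s) ltac:(lra) ltac:(lra).
by rewrite (_ : r + s - (r + t) = s - t)//; ring.
Qed.

Lemma solves_sub U F G T T' q : T' <= T -> solves U F G T q -> solves U F G T' q.
Proof.
move=> TT' [cq sq]; split.
  by apply: continuous_subspaceW cq; apply: subset_itvl; rewrite bnd_simp.
by move=> t /andP[t0 tT]; apply: sq; rewrite t0 (lt_le_trans tT).
Qed.

Lemma solves_congr U F G F' G' T q :
  (forall t, 0 <= t <= T -> F (q t) = F' (q t) /\ G (q t) = G' (q t)) ->
  solves U F G T q -> solves U F' G' T q.
Proof.
move=> FG [cq sq]; split => // t t0T e e0; have /andP[t0 tT] := t0T.
have [<- <-] := FG t ltac:(by rewrite !ltW).
exact: sq.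
Qed.

Lemma solves_shift U F G T q r : 0 <= r -> solves U F G (r + T) q ->
  solves (fun t => U (r + t)) F G T (fun t => q (r + t)).
Proof.
move=> r0 [cq sq]; split.
  apply/(@within_continuousP R _ (fun t => q (r + t)) 0 T) => t /andP[t0 tT] e e0.
  move/within_continuousP: cq => /(_ (r + t) ltac:(apply/andP; split; lra) e e0)[d d0 dP].
  exists d => // s /andP[s0 sT] st; apply: dP; first by apply/andP; split; lra.
  by rewrite (_ : r + s - (r + t) = s - t)//; ring.
move=> t /andP[t0 tT] e e0.
have := sq (r + t) ltac:(apply/andP; split; lra) e e0.
by apply: filterS => h; rewrite !addrA.
Qed.

Lemma solves_bounded U F G T q : solves U F G T q ->
  exists B, forall t, 0 <= t <= T -> `|q t| <= B.
Proof.
move=> [cq _]; have : bounded_set (q @` `[0, T]).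
  exact/compact_bounded/continuous_compact/segment_compact.
move=> [B [_ BP]]; exists (B + 1) => t tT.
by apply: (BP (B + 1)); [rewrite ltrDl|exists t => //; rewrite /= in_itv].
Qed.

(** Gronwall's estimate for the difference of the two solutions. *)
Lemma solves_dist U F G L T q1 q2 : clock U -> 0 <= L -> 0 <= T ->
  solves U F G T q1 -> solves U F G T q2 ->
  (forall t, 0 <= t <= T -> `|F (q1 t) - F (q2 t)| <= L * `|q1 t - q2 t| /\
                            `|G (q1 t) - G (q2 t)| <= L * `|q1 t - q2 t|) ->
  `|q1 T - q2 T| <= `|q1 0 - q2 0| * expR ((L + 1) * T).
Proof.
move=> cU L0 T0 [c1 s1] [c2 s2] FG.
have := @gronwall R _ (fun t => q1 t - q2 t) L 0 T L0 (lexx 0) T0.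
rewrite addr0; apply; first by move=> t; apply: cvgB; [exact: c1|exact: c2].
move=> t t0T e e0; have /andP[t0 tT] := t0T.
have e2 : 0 < e / 2 by rewrite divr_gt0.
have [FL GL] := FG t ltac:(by rewrite !ltW).
apply: filterS3 (nbhs_right_gt 0) (s1 t t0T _ e2) (s2 t t0T _ e2) => h h0 H1 H2.
have := norm_mix_le (clock_step cU (ltW t0) (ltW h0)) FL GL.
set A1 := _ - _ *: G (q1 t) in H1; set A2 := _ - _ *: G (q2 t) in H2.
set A3 := _ *: _ + _ => H3.
have -> : q1 (t + h) - q2 (t + h) - (q1 t - q2 t) = A1 - A2 + A3.
  by rewrite /A1 /A2 /A3 !scalerBr; apply/rowP => i; rewrite !mxE; ring.
have := ler_normD (A1 - A2) A3; have := ler_normB A1 A2; rewrite addr0 => ? ?.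
by apply: (@le_trans _ _ (e / 2 * h + e / 2 * h + L * `|q1 t - q2 t| * h)); lra.
Qed.

Lemma solves_unique U F G T q1 q2 : clock U ->
  locally_lipschitz F -> locally_lipschitz G ->
  solves U F G T q1 -> solves U F G T q2 -> q1 0 = q2 0 ->
  forall t, 0 <= t <= T -> q1 t = q2 t.
Proof.
move=> cU lF lG s1 s2 q0 t /andP[t0 tT].
have [B1 b1] := solves_bounded s1; have [B2 b2] := solves_bounded s2.
have [L1 l1 LF] := lF (Num.max B1 B2); have [L2 l2 LG] := lG (Num.max B1 B2).
have := @solves_dist U F G (Num.max L1 L2) t q1 q2 cU.
rewrite q0 subrr normr0 mul0r normr_le0 subr_eq0 => H; apply/eqP; apply: H => //.
- by rewrite le_max (le_trans ler01 l1).
- exact: solves_sub s1.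
- exact: solves_sub s2.
move=> s /andP[s0 st]; have sT : 0 <= s <= T by rewrite s0 (le_trans st).
have m1 : `|q1 s| <= Num.max B1 B2 by rewrite le_max b1.
have m2 : `|q2 s| <= Num.max B1 B2 by rewrite le_max b2// orbT.
split; [apply: le_trans (LF _ _ m1 m2) _|apply: le_trans (LG _ _ m1 m2) _];
  by rewrite ler_wpM2r// le_max lexx// orbT.
Qed.

(** Near an equilibrium the speed is at most L times the distance to it, so a
    solution that starts elsewhere never reaches it. *)
Lemma solves_lower U F G L T q : clock U -> 0 < L -> 0 <= T -> solves U F G T q ->
  (forall t, 0 <= t <= T -> `|F (q t)| <= L * `|q t| /\ `|G (q t)| <= L * `|q t|) ->
  `|q 0| <= `|q T| * expR (2 * L * T).
Proof.
move=> cU L0 T0 [cq sq] FG; apply: gronwall_lower => // t t0T e e0.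
have /andP[t0 tT] := t0T.
have [FL GL] := FG t ltac:(by rewrite !ltW).
apply: filterS2 (nbhs_right_gt 0) (sq t t0T _ e0) => h h0 H1.
have := norm_mix_le (clock_step cU (ltW t0) (ltW h0)) FL GL.
set A1 := _ - _ *: G (q t) in H1; set A3 := _ *: _ + _ => H3.
have -> : q (t + h) - q t = A1 + A3.
  by rewrite /A1 /A3; apply/rowP => i; rewrite !mxE; ring.
by have := ler_normD A1 A3; lra.
Qed.

(** Subtracting from q the integral of the constant velocities a and b leaves a
    curve of speed at most e. *)
Lemma solves_step U F G T q a b t s e : clock U -> solves U F G T q ->
  0 <= t -> t <= s -> s <= T ->
  (forall r, t <= r <= s -> `|F (q r) - a| <= e /\ `|G (q r) - b| <= e) ->
  `|q s - q t - (U s - U t) *: a - (s - t - (U s - U t)) *: b| <= e * (s - t).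
Proof.
move=> cU sq t0 ts sT ab.
have st0 : 0 <= s - t by rewrite subr_ge0.
have [cq' sq'] : solves (fun r => U (t + r)) F G (s - t) (fun r => q (t + r)).
  by apply: solves_shift => //; apply: solves_sub sq; lra.
have cU' := clock_shift t0 cU.
have cid : {within `[0, s - t], continuous (fun r : R => r)}.
  by apply: continuous_subspaceT => r; exact: cvg_id.
pose f r := q (t + r) - U (t + r) *: a - (r - U (t + r)) *: b.
have -> : q s - q t - (U s - U t) *: a - (s - t - (U s - U t)) *: b = f (s - t) - f 0.
  rewrite /f addrCA subrr !addr0 sub0r; apply/rowP => i; rewrite !mxE; ring.
have := @mean_value_dini R _ f (fun r => e * r) (s - t) st0.
rewrite mulr0 subr0; apply => [|r|r r0T k k0].
- have cUr : {within `[0, s - t], continuous (fun r => U (t + r))}.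
    apply: (lipschitz_within ler01) => r r' r0 rr' _; rewrite mul1r.
    by have /andP[? ?] := cU' r r' r0 rr'; rewrite ger0_norm.
  move=> r; apply: cvgB; [apply: cvgB; first exact: cq'|].
    by apply: cvgZ; [exact: cUr|exact: cvg_cst].
  apply: cvgZ; last exact: cvg_cst.
  by apply: cvgB; [exact: cid|exact: cUr].
- by apply: cvgM; [exact: cvg_cst|exact: cid].
have /andP[r0 rT] := r0T.
have [Fa Gb] := ab (t + r) ltac:(apply/andP; split; lra).
apply: filterS2 (nbhs_right_gt 0) (sq' r r0T k k0) => h h0 H1.
have := norm_mix_le (clock_step cU' (ltW r0) (ltW h0)) Fa Gb.
set A1 := _ - _ *: G (q (t + r)) in H1; set A3 := _ *: _ + _ => H3.
have -> : f (r + h) - f r = A1 + A3.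
  by rewrite /f /A1 /A3; apply/rowP => i; rewrite !mxE; ring.
have := ler_normD A1 A3; lra.
Qed.
End Solves_theory.

(** * Estimates for fields of class C1 and C2 *)

Section Smooth.
Variable R : realType.
Notation V := 'rV[R]_2.
Implicit Types (p x y v c : V) (t s d e h L K T B M a b : R) (f : V -> V).

Lemma derivable_near f p v : derivable f p v -> forall e, 0 < e ->
  \forall h \near 0^'+, `|f (p + h *: v) - f p - h *: 'D_v f p| <= e * h.
Proof.
move=> df e e0.
have /cvgrPdist_lt /(_ e e0) := df.
rewrite -/(derive f p v).
move=> [d /= d0 dP]; exists d => //= h hd h0.
have := dP h hd (lt0r_neq0 h0).
rewrite /= [h *: v + p]addrC => H.
have -> : f (p + h *: v) - f p - h *: 'D_v f p =
    - (h *: ('D_v f p - h^-1 *: (f (p + h *: v) - f p))).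
  by rewrite scalerBr scalerA divff ?lt0r_neq0// scale1r opprB.
rewrite normrN normrZ (gtr0_norm h0) mulrC ler_pM2r//; exact: ltW.
Qed.

Lemma continuous_line p v T : {within `[0, T], continuous (fun t => p + t *: v)}.
Proof.
apply: (@lipschitz_within _ _ _ `|v|) => // t s t0 ts sT.
by rewrite opprD addrACA subrr add0r -scalerBl normrZ mulrC ger0_norm ?subr_ge0.
Qed.

Lemma derive_mean_value f p v c K T : 0 <= T -> (forall x, derivable f x v) ->
  (forall t, 0 <= t <= T -> `|'D_v f (p + t *: v) - c| <= K) ->
  continuous f ->
  `|f (p + T *: v) - f p - T *: c| <= K * T.
Proof.
move=> T0 df dfK cf.
have cc : {within `[0, T], continuous (fun t => t *: c)}.
  have := @continuous_line 0 c T.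
  by rewrite (_ : (fun t => 0 + t *: c) = fun t => t *: c)//; apply/funext => s; rewrite add0r.
pose g t := f (p + t *: v) - t *: c.
have -> : f (p + T *: v) - f p - T *: c = g T - g 0.
  by rewrite /g !scale0r addr0 subr0 addrAC.
have := @mean_value_dini R _ g (fun r => K * r) T T0.
rewrite mulr0 subr0; apply => [t|t|t t0T e e0].
- apply: cvgB; first exact: (within_continuous_comp cf (@continuous_line p v T)).
  exact: cc.
- apply: cvgM; first exact: cvg_cst.
  by apply: (@continuous_subspaceT _ _ _ (fun r : R => r)) => r; exact: cvg_id.
have /andP[t0 tT] := t0T.
have K1 := dfK t ltac:(by rewrite !ltW).
apply: filterS2 (nbhs_right_gt 0) (derivable_near (df (p + t *: v)) e0) => h h0 H1.
rewrite /g scalerDl addrA.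
set D := 'D_v f _ in K1 H1.
have -> : f (p + t *: v + h *: v) - (t + h) *: c - (f (p + t *: v) - t *: c) =
   (f (p + t *: v + h *: v) - f (p + t *: v) - h *: D) + h *: (D - c).
  by apply/rowP => i; rewrite !mxE; ring.
apply: le_trans (ler_normD _ _) _; rewrite [`|h *: _|]normrZ (gtr0_norm h0).
have := ler_wpM2l (ltW h0) K1; lra.
Qed.

Lemma derive_mean_value_norm f p v c K a : (forall x, derivable f x v) ->
  (forall t, `|t| <= `|a| -> `|'D_v f (p + t *: v) - c| <= K) ->
  continuous f ->
  `|f (p + a *: v) - f p - a *: c| <= K * `|a|.
Proof.
move=> df dfK cf; have [a0|a0] := leP 0 a.
  rewrite (ger0_norm a0) in dfK *; apply: derive_mean_value => // t /andP[t0 ta].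
  by apply: dfK; rewrite ger0_norm.
have na0 : 0 <= - a by lra.
have := @derive_mean_value f (p + a *: v) v c K (- a) na0 df _ cf.
rewrite scaleNr addrK scaleNr opprK (ltr0_norm a0) => H.
rewrite (_ : _ - _ - _ = - (f p - f (p + a *: v) + a *: c)); last by rewrite opprD opprB.
rewrite normrN; apply: H => t /andP[t0 ta].
rewrite -addrA -scalerDl; apply: dfK.
by rewrite (ltr0_norm a0) ler0_norm; lra.
Qed.

Definition jac f y v : V := v 0 0 *: 'D_'e_0 f y + v 0 1 *: 'D_'e_1 f y.

Lemma closed_norm_le (W : normedModType R) M : closed [set x : W | `|x| <= M].
Proof.
have -> : [set x : W | `|x| <= M] = Num.norm @^-1` [set r : R | r <= M] by [].
apply: preimage_closed; last exact: closed_le.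
by move=> x _; exact: norm_continuous.
Qed.

Lemma continuous_ball_bounded f M : continuous f -> exists B, forall x, `|x| <= M -> `|f x| <= B.
Proof.
move=> cf; have cM : compact [set x : V | `|x| <= M].
  apply: bounded_closed_compact.
    by exists M; split; [exact: num_real|move=> N MN x /= xM; rewrite (le_trans xM)// ltW].
  exact: closed_norm_le.
have : bounded_set (f @` [set x : V | `|x| <= M]).
  by apply/compact_bounded/continuous_compact => //; exact: continuous_subspaceT.
by move=> [B [_ BP]]; exists (B + 1) => x xM; apply: (BP (B + 1)); [rewrite ltrDl|exists x].
Qed.
Lemma row2_split x y : x = y + (x 0 0 - y 0 0) *: 'e_0 + (x 0 1 - y 0 1) *: 'e_1.
Proof.
apply/rowP => i; rewrite !mxE !eqxx/=.
have [->|i0] := eqVneq i 0; first by rewrite mulr1 mulr0; ring.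
have -> : i = 1 by apply/val_inj; case: i i0 => -[|[|]].
by rewrite mulr0 mulr1; ring.
Qed.

Lemma norm_e i : `|'e_i : V| <= 1.
Proof.
apply/row_norm_le => // j; rewrite !mxE eqxx/=.
by case: eqP => _; rewrite ?normr1// normr0.
Qed.

(** The path from y to x made of two segments parallel to the axes reduces the
    claim to the mean value inequality for directional derivatives. *)
Lemma derive_increment f x y c0 c1 K M : continuous f ->
  (forall i p, derivable f p 'e_i) -> `|x| <= M -> `|y| <= M -> 0 <= K ->
  (forall z, `|z| <= 5 * M -> `|z - y| <= 2 * `|x - y| ->
    `|'D_'e_0 f z - c0| <= K /\ `|'D_'e_1 f z - c1| <= K) ->
  `|f x - f y - (x 0 0 - y 0 0) *: c0 - (x 0 1 - y 0 1) *: c1| <= 2 * K * `|x - y|.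
Proof.
move=> cf df xM yM K0 DK.
set a := x 0 0 - y 0 0; set b := x 0 1 - y 0 1.
have M0 : 0 <= M by apply: le_trans yM.
have ax : `|a| <= `|x - y| by have := coord_le_norm (x - y) 0; rewrite !mxE.
have bx : `|b| <= `|x - y| by have := coord_le_norm (x - y) 1; rewrite !mxE.
have xy2 : `|x - y| <= 2 * M by apply: le_trans (ler_normB _ _) _; lra.
have scale (i : 'I_2) r : `|r| <= `|x - y| -> `|r *: ('e_i : V)| <= `|x - y|.
  move=> rx; rewrite normrZ; apply: le_trans rx.
  by rewrite ler_piMr// norm_e.
have H0 : `|f (y + a *: 'e_0) - f y - a *: c0| <= K * `|a|.
  apply: derive_mean_value_norm => // t ta; apply: (DK _ _ _).1.
    apply: le_trans (ler_normD _ _) _.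
    by have := scale 0 t (le_trans ta ax); lra.
  by rewrite addrAC subrr add0r; have := scale 0 t (le_trans ta ax); have := normr_ge0 (x - y); lra.
have H1 : `|f (y + a *: 'e_0 + b *: 'e_1) - f (y + a *: 'e_0) - b *: c1| <= K * `|b|.
  apply: derive_mean_value_norm => // t ta; apply: (DK _ _ _).2.
    apply: le_trans (ler_normD _ _) _.
    have := scale 1 t (le_trans ta bx).
    have := ler_normD y (a *: 'e_0); have := scale 0 a ax; lra.
  rewrite (_ : _ - y = a *: 'e_0 + t *: 'e_1); last by apply/rowP => i; rewrite !mxE; ring.
  apply: le_trans (ler_normD _ _) _.
  by have := scale 1 t (le_trans ta bx); have := scale 0 a ax; lra.
rewrite -row2_split in H1.
have -> : f x - f y - a *: c0 - b *: c1 =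
  (f x - f (y + a *: 'e_0) - b *: c1) + (f (y + a *: 'e_0) - f y - a *: c0).
  by apply/rowP => i; rewrite !mxE; ring.
apply: le_trans (ler_normD _ _) _; nra.
Qed.

Lemma class_C1_lipschitz f : class_C 1 f -> locally_lipschitz f.
Proof.
move=> [cf df] M.
have [B0 b0] := continuous_ball_bounded (5 * M) (df 0).2.1.
have [B1 b1] := continuous_ball_bounded (5 * M) (df 1).2.1.
pose K := Num.max 0 (Num.max B0 B1).
have K0 : 0 <= K by rewrite le_max lexx.
exists (2 * K + 1); first by lra.
move=> x y xM yM.
have := @derive_increment f x y 0 0 K M cf (fun i => (df i).1) xM yM K0.
rewrite !scaler0 !subr0 => H.
have : 2 * K * `|x - y| <= (2 * K + 1) * `|x - y| by rewrite ler_wpM2r// lerDl.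
apply: le_trans; apply: H => z zM _; rewrite !subr0; split.
  by rewrite /K !le_max b0// orbT.
by rewrite /K !le_max b1// !orbT.
Qed.

Definition quadratic_remainder f := forall M, exists2 C, 0 <= C &
  forall x y, `|x| <= M -> `|y| <= M ->
    `|f x - f y - jac f y (x - y)| <= C * `|x - y| ^+ 2.

(** The partial derivatives are Lipschitz, hence along the path from y to x they
    differ from their values at y by a multiple of `|x - y|. *)
Lemma class_C2_quadratic f : class_C 2 f -> quadratic_remainder f.
Proof.
move=> [cf df] M.
have [L0 l0 lip0] := class_C1_lipschitz (df 0).2 (Num.max M (5 * M)).
have [L1 l1 lip1] := class_C1_lipschitz (df 1).2 (Num.max M (5 * M)).
pose L := Num.max L0 L1.
have L00 : 0 <= L by rewrite le_max (le_trans ler01 l0).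
exists (4 * L); first by lra.
move=> x y xM yM.
have := @derive_increment f x y ('D_'e_0 f y) ('D_'e_1 f y) (2 * L * `|x - y|) M
  cf (fun i => (df i).1) xM yM.
rewrite /jac !mxE opprD addrA => H.
rewrite expr2 (_ : 4 * L * _ = 2 * (2 * L * `|x - y|) * `|x - y|); last by ring.
apply: H => [|z zM zy]; first by rewrite !mulr_ge0.
have zM' : `|z| <= Num.max M (5 * M) by rewrite le_max zM orbT.
have yM' : `|y| <= Num.max M (5 * M) by rewrite le_max yM.
have LL : L * `|z - y| <= 2 * L * `|x - y| by have := ler_wpM2l L00 zy; lra.
split; apply: le_trans LL.
  by apply: le_trans (lip0 _ _ zM' yM') _; rewrite ler_wpM2r// le_max lexx.
by apply: le_trans (lip1 _ _ zM' yM') _; rewrite ler_wpM2r// le_max lexx orbT.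
Qed.

End Smooth.

(** * Integral curves of one field *)

Section Flows.
Variable R : realType.
Notation V := 'rV[R]_2.
Implicit Types (p x y : V) (t s d e h L K T B M a b c r : R).
Implicit Types (F X : V -> V) (q : R -> V) (Ts : \bar R).

Lemma eball_norm d p : eball d p -> `|p| < d.
Proof.
rewrite /eball/= => pd; apply: le_lt_trans pd; apply/row_norm_le; first exact: sqrtr_ge0.
move=> i; rewrite -sqrtr_sqr ler_sqrt ?sumr_ge0// => [|j _]; last exact: sqr_ge0.
by rewrite (bigD1 i)//= lerDl sumr_ge0// => j _; exact: sqr_ge0.
Qed.

Lemma norm_eball d p : `|p| < d / 2 -> eball d p.
Proof.
rewrite /eball/= => pd; have d0 : 0 < d by have := normr_ge0 p; lra.
rewrite -(ger0_norm (ltW d0)) -sqrtr_sqr ltr_sqrt ?exprn_gt0// big_ord_recl big_ord1.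
have := coord_le_norm p ord0; have := coord_le_norm p (lift ord0 ord0).
rewrite !ler_norml => /andP[? ?] /andP[? ?]; nra.
Qed.

Definition clamp M x : V := \row_i Num.max (- M) (Num.min M (x 0 i)).

Lemma max_lipschitz c a b : `|Num.max c a - Num.max c b| <= `|a - b|.
Proof.
have h1 := ler_norm (a - b); have h2 := ler_norm (b - a); rewrite distrC in h2.
by rewrite ler_norml; case: (leP c a) => ?; case: (leP c b) => ?; apply/andP; split; lra.
Qed.

Lemma min_lipschitz c a b : `|Num.min c a - Num.min c b| <= `|a - b|.
Proof.
have h1 := ler_norm (a - b); have h2 := ler_norm (b - a); rewrite distrC in h2.
by rewrite ler_norml; case: (leP c a) => ?; case: (leP c b) => ?; apply/andP; split; lra.
Qed.

Lemma clamp_lipschitz M x y : `|clamp M x - clamp M y| <= `|x - y|.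
Proof.
apply/row_norm_le => // i; have := coord_le_norm (x - y) i; rewrite !mxE.
by apply: le_trans; apply: le_trans (max_lipschitz _ _ _) (min_lipschitz _ _ _).
Qed.

Lemma clamp_id M x : `|x| <= M -> clamp M x = x.
Proof.
move=> xM; apply/rowP => i; have := le_trans (coord_le_norm x i) xM.
by rewrite !mxE ler_norml => /andP[Mx xM']; rewrite min_r// max_r.
Qed.

Lemma clamp_bounded M x : 0 <= M -> `|clamp M x| <= M.
Proof.
move=> M0; apply/row_norm_le => // i; rewrite mxE ler_norml le_max lexx/=.
by rewrite ge_max ge_min lexx/= andbT; lra.
Qed.

Lemma locally_lipschitz_bounded F M : locally_lipschitz F ->
  exists2 B, 0 <= B & forall x, `|x| <= M -> `|F x| <= B.
Proof.
move=> /(_ (Num.max 0 M))[L L1 FL]; have L0 : 0 <= L := le_trans ler01 L1.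
have M0 : 0 <= Num.max 0 M by rewrite le_max lexx.
exists (`|F 0| + L * Num.max 0 M); first by rewrite addr_ge0// mulr_ge0.
move=> x xM; have xM' : `|x| <= Num.max 0 M by rewrite le_max xM orbT.
have := FL x 0 xM'; rewrite normr0 subr0 => /(_ M0).
have := ler_normD (F x - F 0) (F 0); rewrite subrK.
have := ler_wpM2l L0 xM'; lra.
Qed.

(** Composing with the projection onto a box turns a locally Lipschitz field into
    a bounded and globally Lipschitz one, equal to it in the box. *)
Lemma clamped_global F M : locally_lipschitz F -> 0 <= M -> exists L B, [/\ 1 <= L,
  (forall x y, `|F (clamp M x) - F (clamp M y)| <= L * `|x - y|) &
  (forall x, `|F (clamp M x)| <= B)].
Proof.
move=> lF M0; have [L L1 FL] := lF M; have [B B0 FB] := locally_lipschitz_bounded M lF.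
exists L, B; split => // x; last by apply: FB; exact: clamp_bounded.
move=> y; apply: le_trans (FL _ _ (clamp_bounded _ M0) (clamp_bounded _ M0)) _.
by apply: ler_wpM2l; [exact: le_trans ler01 L1|exact: clamp_lipschitz].
Qed.

(** When the two modes coincide their contributions add up to h *: F (q t). *)
Lemma solves_clock U U' F T q : solves U F F T q -> solves U' F F T q.
Proof.
move=> [cq sq]; split => // t t0T e e0; apply: filterS (sq t t0T e e0) => h.
by rewrite -!addrA -!opprD -!scalerDl !(addrC _ (h - _)) !subrK.
Qed.

Lemma solves_is_derive F T q t : continuous F -> solves id F F T q -> 0 < t < T ->
  is_derive t (1 : R) q (F (q t)).
Proof.
move=> cF sq /andP[t0 tT].
have tTT : 0 <= t <= T by rewrite !ltW.
have lim : h^-1 *: (q (h *: 1 + t) - q t) @[h --> 0^'] --> F (q t).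
  apply/cvgrPdist_le => e e0.
  have := within_continuous_comp cF sq.1.
  move=> /within_continuousP /(_ t tTT e e0)[d d0 dP].
  pose m := Num.min d (Num.min t (T - t)).
  have m0 : 0 < m by rewrite !lt_min d0 t0 subr_gt0.
  exists m => //= h /=; rewrite sub0r normrN !lt_min => /andP[hd /andP[ht hT]] h0.
  have [ht1 ht2] : - h < t /\ h < T - t.
    by split; [apply: le_lt_trans ht; rewrite -normrN ler_norm|
                 apply: le_lt_trans hT; exact: ler_norm].
  have near r : 0 <= r -> r <= T -> `|r - t| <= `|h| -> `|F (q r) - F (q t)| <= e.
    by move=> r0 rT rt; apply/ltW/dP; [rewrite r0|exact: le_lt_trans rt hd].
  have main : `|q (h *: 1 + t) - q t - h *: F (q t)| <= e * `|h|.
    rewrite [h *: 1]mulr1 (addrC h t).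
    have [h1|h1] := leP 0 h.
      have := @solves_step _ _ _ _ _ _ (F (q t)) (F (q t)) t (t + h) e (@clock_id R) sq (ltW t0).
      rewrite [t + h - t]addrAC subrr add0r (ger0_norm h1) /= => H.
      rewrite subrr scale0r subr0 in H; apply: H; [lra|lra|].
      by move=> r /andP[tr rh]; split; apply: near; [lra|lra| |lra|lra|];
        rewrite !ger0_norm; lra.
    have := @solves_step _ _ _ _ _ _ (F (q t)) (F (q t)) (t + h) t e (@clock_id R) sq.
    rewrite opprD addrA subrr add0r (ltr0_norm h1) /= subrr scale0r subr0 => H.
    rewrite -normrN.
    have -> : - (q (t + h) - q t - h *: F (q t)) = q t - q (t + h) - - h *: F (q t).
      by rewrite scaleNr opprD opprB.
    apply: H; [lra|lra|lra|].
    by move=> r /andP[tr rh]; split; apply: near; [lra|lra| |lra|lra|];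
      rewrite !ler0_norm; lra.
  rewrite distrC; have -> : h^-1 *: (q (h *: 1 + t) - q t) - F (q t) =
     h^-1 *: (q (h *: 1 + t) - q t - h *: F (q t)).
    by rewrite [RHS]scalerBr scalerA mulVf// scale1r.
  by rewrite normrZ normfV mulrC ler_pdivrMr ?normr_gt0.
apply: DeriveDef; first by apply/cvg_ex; exists (F (q t)).
exact: cvg_lim lim.
Qed.

Lemma integral_curve_solves X p Ts q T : integral_curve X p Ts q -> (T%:E < Ts)%E ->
  solves id X X T q.
Proof.
move=> [_ _ cq dq] TTs; split.
  apply: continuous_subspaceW cq => t; rewrite /= in_itv/= => /andP[t0 tT]; split => //.
  by apply: le_lt_trans TTs; rewrite lee_fin.
move=> t /andP[t0 tT] e e0.
have tTs : (t%:E < Ts)%E by apply: lt_trans TTs; rewrite lte_fin.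
have [dqt <-] := dq t t0 tTs.
move: dqt => /cvgrPdist_lt /(_ e e0); rewrite -/(derive q t 1).
move=> [d /= d0 dP]; exists d => //= h hd h0.
have := dP h hd (lt0r_neq0 h0).
have -> : id (t + h) - id t = h by rewrite /= addrAC subrr add0r.
rewrite subrr scale0r subr0 /= [h *: 1]mulr1 (addrC h t) => H.
have -> : q (t + h) - q t - h *: 'D_1 q t =
    - (h *: ('D_1 q t - h^-1 *: (q (t + h) - q t))).
  by rewrite scalerBr scalerA divff ?lt0r_neq0// scale1r opprB.
rewrite normrN normrZ (gtr0_norm h0) mulrC ler_pM2r//; exact: ltW.
Qed.

Lemma solves_integral_curve X T q : continuous X -> 0 < T -> solves id X X T q ->
  integral_curve X (q 0) T%:E q.
Proof.
move=> cX T0 sq; split => //.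
  apply: continuous_subspaceW sq.1 => t [t0]; rewrite lte_fin => tT.
  by rewrite /= in_itv/= t0 ltW.
by move=> t t0; rewrite lte_fin => tT; apply: solves_is_derive sq _ => //; rewrite t0.
Qed.

(** The global solution for the field projected on a box around p stays in that
    box for a short time. *)
Lemma integral_curve_local X p : continuous X -> locally_lipschitz X ->
  exists2 T, 0 < T & exists q, integral_curve X p T%:E q.
Proof.
move=> cX lX; pose M := `|p| + 1.
have M0 : 0 <= M by rewrite addr_ge0.
have [L [B [L1 XL XB]]] := clamped_global lX M0.
have B0 : 0 <= B := le_trans (normr_ge0 _) (XB 0).
have s1 : @switching R (fun=> 1).
  by split; [exact: measurable_cst|move=> t _; rewrite ler01 lexx].
have [q [qE cq]] := picard_fixpoint s1 L1 XL XL XB XB p.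
have q0 : q 0 = p by rewrite qE// picard0.
pose T := (B + 1)^-1; have B1 : 0 < B + 1 by rewrite ltr_wpDl.
have T0 : 0 < T by rewrite invr_gt0.
exists T => //; exists q; rewrite -[X in integral_curve _ X]q0.
have cXM : continuous (X \o clamp M) := lipschitz_continuous (le_trans ler01 L1) XL.
have qM t : 0 <= t <= T -> `|q t| <= M.
  move=> /andP[t0 tT]; have := picard_lipschitz s1 L1 XL XL XB XB p (cq T) (lexx 0) t0 tT.
  rewrite -!qE// q0 subr0 => H.
  have : B * t <= 1.
    by apply: le_trans (ler_wpM2l B0 tT) _; rewrite ler_pdivrMr// mul1r lerDl.
  have := ler_normD (q t - p) p; rewrite subrK /M; lra.
apply: solves_integral_curve => //.
apply: (@solves_clock (mode_time (fun=> 1))).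
apply: (@solves_congr _ _ (X \o clamp M) (X \o clamp M)).
  by move=> t tT; rewrite /= clamp_id// qM.
split; first exact: cq.
move=> t /andP[t0 tT] e e0; have t0T : 0 <= t < T by rewrite ltW.
apply: filterS2 (nbhs_right_gt 0) (picard_solves s1 cXM cXM p (ltW T0) (cq T) t0T e0) => h h0.
by rewrite -!qE//; lra.
Qed.
End Flows.

(** * Maximal integral curves and stable flows *)

Section Maximal_curves.
Variable R : realType.
Notation V := 'rV[R]_2.
Implicit Types (p x y : V) (t s d e h L K T B M a b r : R).
Implicit Types (F X : V -> V) (q : R -> V) (Ts : \bar R).

Lemma integral_curve_restrict X p Ts q T : integral_curve X p Ts q -> 0 < T ->
  (T%:E <= Ts)%E -> integral_curve X p T%:E q.
Proof.
move=> [_ q0 cq dq] T0 TTs; split => //.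
  by apply: continuous_subspaceW cq => t [t0 tT]; split => //; exact: lt_le_trans TTs.
by move=> t t0 tT; apply: dq => //; exact: lt_le_trans TTs.
Qed.

Lemma integral_curve_unique X p T1 T2 q1 q2 : locally_lipschitz X ->
  integral_curve X p T1%:E q1 -> integral_curve X p T2%:E q2 ->
  forall t, 0 <= t -> t < T1 -> t < T2 -> q1 t = q2 t.
Proof.
move=> lX i1 i2 t t0 t1 t2.
apply: (@solves_unique _ id X X t q1 q2) => //.
- exact: clock_id.
- by apply: integral_curve_solves i1 _; rewrite lte_fin.
- by apply: integral_curve_solves i2 _; rewrite lte_fin.
- by case: i1 => _ -> _ _; case: i2 => _ -> _ _.
- by rewrite t0 lexx.
Qed.

(** Integral curves from p agree on their common domain, so they glue to a curve
    on the supremum of their life spans. *)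
Lemma maximal_integral_curve X p : continuous X -> locally_lipschitz X ->
  exists Ts q, maximal (integral_curve X p) Ts q.
Proof.
move=> cX lX; pose D := [set Ts | exists q, integral_curve X p Ts q].
pose Ts := ereal_sup D; exists Ts.
have Tspos : (0 < Ts)%E.
  have [T T0 Tq] := integral_curve_local p cX lX.
  by apply: (@lt_le_trans _ _ T%:E); [rewrite lte_fin|exact: ereal_sup_ubound].
have /choice [c cP] t : exists Tq : R * (R -> V), 0 <= t -> (t%:E < Ts)%E ->
    [/\ 0 <= t, t < Tq.1, (Tq.1%:E <= Ts)%E & integral_curve X p Tq.1%:E Tq.2].
  have [[t0 tTs]|nt] := pselect (0 <= t /\ (t%:E < Ts)%E); last first.
    by exists (0, fun=> 0) => t0 tTs; case: nt.
  have [T' [q Dq] tT'] := ereal_sup_gt tTs.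
  have T'Ts : (T' <= Ts)%E by apply: ereal_sup_ubound; exists q.
  have [T tT TT'] : exists2 T, t < T & (T%:E <= T')%E.
    case: T' tT' {T'Ts Dq} => [r| |]//; last by exists (t + 1); [rewrite ltrDl|rewrite leey].
    by rewrite lte_fin => tr; exists r.
  exists (T, q) => _ _; split => //=; first exact: le_trans T'Ts.
  by apply: integral_curve_restrict Dq _ TT'; exact: le_lt_trans tT.
pose q t := (c t).2 t.
have qE t s : 0 <= t -> (t%:E < Ts)%E -> 0 <= s -> s < (c t).1 -> q s = (c t).2 s.
  move=> t0 tTs s0 sT; have [_ tT TTs it] := cP t t0 tTs.
  have sTs : (s%:E < Ts)%E by apply: lt_le_trans TTs; rewrite lte_fin.
  have [_ sT' _ is_] := cP s s0 sTs.
  exact: integral_curve_unique lX is_ it s s0 sT' sT.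
exists q; split; last by move=> T' q' iq' _; apply: ereal_sup_ubound; exists q'.
split => //.
- have [_ _ _ [_ + _ _]] := cP 0 (lexx 0) Tspos; exact.
- apply/within_cont_distP => t [t0 tTs] e e0.
  have [_ tT TTs it] := cP t t0 tTs.
  have [_ _ /within_cont_distP ct _] := it.
  have tT' : (t%:E < (c t).1%:E)%E by rewrite lte_fin.
  have [d d0 dP] := ct t (conj t0 tT') e e0.
  exists (Num.min d ((c t).1 - t)); first by rewrite lt_min d0 subr_gt0.
  move=> s [s0 sTs]; rewrite lt_min => /andP[sd sT].
  have sT1 : s < (c t).1 by have := ler_norm (s - t); lra.
  rewrite (qE t s)// (qE t t)//; apply: dP => //; split => //.
- move=> t t0 tTs; have [_ tT TTs it] := cP t (ltW t0) tTs.
  have [_ _ _ dt] := it.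
  rewrite (qE t t (ltW t0) tTs (ltW t0) tT).
  apply: (@near_eq_is_derive _ _ _ (c t).2).
    near=> s; apply/esym/qE => //; first exact: ltW.
      by apply: ltW; near: s; exact: lt_nbhsr.
    by near: s; exact: lt_nbhsl.
  by apply: dt => //; rewrite lte_fin.
Unshelve. all: end_near. Qed.

(** Forward flow of a field for which the origin is globally asymptotically
    stable; times are meant to be nonnegative. *)
Record stable_flow X (phi : R -> V -> V) : Prop := StableFlow {
  flow_start : forall p, phi 0 p = p;
  flow_solves : forall p T, solves id X X T (phi ^~ p);
  flow_stable : forall e, 0 < e -> exists2 d, 0 < d &
    forall p, `|p| < d -> forall t, 0 <= t -> `|phi t p| < e;
  flow_attractive : forall p e, 0 < e -> exists T, forall t, T <= t -> `|phi t p| < e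
}.

(** Global attractivity speaks of maximal integral curves; their existence
    yields a flow defined for all positive times. *)
Lemma gas_stable_flow X : continuous X -> locally_lipschitz X ->
  vf_globally_asymptotically_stable X -> exists phi, stable_flow X phi.
Proof.
move=> cX lX [X0 stX attX].
have /choice [c cP] p : exists q, integral_curve X p +oo%E q /\ q t @[t --> +oo] --> (0 : V).
  have [Ts [q mq]] := maximal_integral_curve p cX lX.
  have [Tsoo q0] := attX p Ts q mq; exists q; split => //.
  by rewrite -Tsoo; case: mq.
exists (fun t p => c p t); split => [p|p T|e e0|p e e0].
- by have [[_ + _ _] _] := cP p.
- have [ip _] := cP p; exact: integral_curve_solves ip (ltry _).
- have [d d0 dP] := stX e e0; exists (d / 2); first by rewrite divr_gt0.
  move=> p pd t t0; apply: eball_norm.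
  have [ip _] := cP p; apply: (dP p +oo%E (c p)) => //; first exact: norm_eball.
  by split => //; rewrite ltry.
- have [_ /cvgrPdist_lt /(_ e e0)] := cP p.
  move=> [T [_ TP]]; exists (T + 1) => t tT.
  by have := TP t ltac:(lra); rewrite sub0r normrN.
Qed.
End Maximal_curves.

(** * Uniform properties of a stable flow *)

Section Uniform_flow.
Variable R : realType.
Notation V := 'rV[R]_2.
Implicit Types (p x y : V) (t s d e h L K T B M a b r : R).

Lemma nbhs_norm_lt (W : normedModType R) (x : W) d : 0 < d -> nbhs x [set y | `|x - y| < d].
Proof. by move=> d0; apply/nbhs_normP; exists d. Qed.

(** Compactness of closed balls: a property that is monotone in T and holds near
    each point for some T holds on the ball for a common T. *)
Lemma closed_ball_uniform (P : R -> V -> Prop) M :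
  (forall T T' p, T <= T' -> P T p -> P T' p) ->
  (forall p0, exists T, exists2 d, 0 < d & forall p, `|p - p0| < d -> P T p) ->
  exists T, forall p, `|p| <= M -> P T p.
Proof.
move=> mono loc.
have cM : compact [set x : V | `|x| <= M].
  apply: bounded_closed_compact; last exact: closed_norm_le.
  by exists M; split; [exact: num_real|move=> N MN x /= xM; rewrite (le_trans xM)// ltW].
have := (compact_near_coveringP _).1 cM R (pinfty_nbhs R) P _.
move=> /(_ _)[].
  move=> p0 _; have [T [d d0 dP]] := loc p0.
  exists ([set p | `|p0 - p| < d], [set T' | T <= T']) => /=.
    split; last by exists T; split; [exact: num_real|move=> T' /ltW].
    exact: nbhs_norm_lt.
  by move=> [p T'] /= [pd TT']; apply: mono TT' _; apply: dP; rewrite distrC.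
move=> T [_ TP]; exists (T + 1) => p pM; apply: (TP (T + 1)) => //.
by rewrite ltrDl.
Qed.

Variables (X : V -> V) (phi : R -> V -> V).
Hypotheses (lX : locally_lipschitz X) (fX : stable_flow X phi).

Lemma flow_semigroup p s t : 0 <= s -> 0 <= t -> phi (s + t) p = phi t (phi s p).
Proof.
move=> s0 t0; have := flow_solves fX p (s + t) => /(solves_shift s0) /= H.
apply: (@solves_unique _ id X X t (fun t => phi (s + t) p) (phi ^~ (phi s p))) => //.
- exact: clock_id.
- exact: solves_clock H.
- exact: (flow_solves fX).
- by rewrite addr0 (flow_start fX).
- by rewrite t0 lexx.
Qed.

Lemma flow_orbit_bounded p : exists B, forall t, 0 <= t -> `|phi t p| <= B.
Proof.
have [T TP] := flow_attractive fX p (ltr01).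
have [B BP] := solves_bounded (flow_solves fX p T).
exists (Num.max B 1) => t t0; rewrite le_max.
by have [tT|/ltW Tt] := leP t T; [rewrite BP// t0|rewrite (ltW (TP t Tt)) orbT].
Qed.

(** As long as the two orbits are at distance at most 1 they remain in a fixed
    ball, where Gronwall's estimate keeps them at distance less than 1. *)
Lemma flow_continuous_dependence p0 T e : 0 <= T -> 0 < e -> exists2 d, 0 < d &
  forall p, `|p - p0| < d -> forall t, 0 <= t <= T -> `|phi t p - phi t p0| < e.
Proof.
move=> T0 e0; have [B BP] := flow_orbit_bounded p0.
have [L L1 LP] := lX (B + 1).
pose E := expR ((L + 1) * T); have E0 : 0 < E by exact: expR_gt0.
(* Distance 1 is what keeps the second orbit in the ball of radius B + 1. *)
pose c := Num.min e 1; have c0 : 0 < c by rewrite lt_min e0 ltr01.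
exists (c / E) => [|p pd]; first by rewrite divr_gt0.
have pc : `|p - p0| * E < c by rewrite -ltr_pdivlMr.
move=> t tT; apply: (@lt_le_trans _ _ c); last by rewrite ge_min lexx.
apply: le_lt_trans pc.
have E1 : 1 <= E by rewrite -expR0 ler_expR mulr_ge0//; have := L1; lra.
apply: (@continuation _ (fun t => `|phi t p - phi t p0|) T _ 1) tT => //.
- apply: continuous_within_norm => s.
  by apply: cvgB; [exact: (flow_solves fX p T).1|exact: (flow_solves fX p0 T).1].
- by apply: (lt_le_trans (_ : _ < c)); [rewrite -ltr_pdivlMr|rewrite ge_min lexx orbT].
- by rewrite !(flow_start fX) ler_peMr.
move=> s /andP[s0 sT] near1.
have := @solves_dist _ id X X L s (phi ^~ p) (phi ^~ p0) (@clock_id R) (le_trans ler01 L1) s0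
  (flow_solves fX p s) (flow_solves fX p0 s).
rewrite !(flow_start fX) => H; apply: le_trans (H _) _.
  move=> r /andP[r0 rs].
  have B0 := BP r r0; have n1 := near1 r ltac:(by rewrite r0).
  have := ler_normD (phi r p - phi r p0) (phi r p0); rewrite subrK => n2.
  by split; apply: LP; lra.
by rewrite ler_wpM2l// ler_expR ler_wpM2l//; have := L1; lra.
Qed.

(** Once an orbit has entered the neighbourhood given by stability it stays
    close to 0 forever; the entrance time is locally bounded by continuous
    dependence. *)
Lemma flow_uniformly_attractive M e : 0 < e -> exists2 T, 0 <= T &
  forall p, `|p| <= M -> forall t, T <= t -> `|phi t p| < e.
Proof.
move=> e0; have [d d0 dP] := flow_stable fX e0.
have := @closed_ball_uniform (fun T p => forall t, 0 <= t -> T <= t -> `|phi t p| < e) M.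
move=> /(_ _ _)[].
- by move=> T T' p TT' H t t0 T't; apply: H => //; exact: le_trans T't.
- move=> p0; have [T TP] := flow_attractive fX p0 (divr_gt0 d0 (ltr0n _ 2)).
  pose T1 := Num.max 0 T; have T10 : 0 <= T1 by rewrite le_max lexx.
  have TT1 : T <= T1 by rewrite le_max lexx orbT.
  have [k k0 kP] := flow_continuous_dependence p0 T10 (divr_gt0 d0 (ltr0n _ 2)).
  exists T1, k => // p pk t t0 Tt.
  have -> : t = T1 + (t - T1) by rewrite addrC subrK.
  rewrite flow_semigroup// ?subr_ge0//; apply: dP; last by rewrite subr_ge0.
  have h1 := kP p pk T1 ltac:(by rewrite T10 lexx); have h2 := TP T1 TT1.
  by have := ler_normD (phi T1 p - phi T1 p0) (phi T1 p0); rewrite subrK; lra.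
move=> T TP; exists (Num.max 0 T) => [|p pM t]; first by rewrite le_max lexx.
by rewrite ge_max => /andP[t0 Tt]; exact: TP.
Qed.

Lemma flow_uniformly_bounded M : exists2 B, 0 <= B &
  forall p, `|p| <= M -> forall t, 0 <= t -> `|phi t p| <= B.
Proof.
have [T T0 TP] := flow_uniformly_attractive M ltr01.
have := @closed_ball_uniform (fun B p => forall t, 0 <= t <= T -> `|phi t p| <= B) M.
move=> /(_ _ _)[].
- by move=> B B' p BB' H t tT; exact: le_trans (H t tT) BB'.
- move=> p0; have [B BP] := flow_orbit_bounded p0.
  have [k k0 kP] := flow_continuous_dependence p0 T0 ltr01.
  exists (B + 1), k => // p pk t tT; have /andP[t0 _] := tT.
  have h1 := kP p pk t tT; have h2 := BP t t0.
  by have := ler_normD (phi t p - phi t p0) (phi t p0); rewrite subrK; lra.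
move=> B BP; exists (Num.max 1 B) => [|p pM t t0]; first by rewrite le_max ler01.
rewrite le_max; have [tT|/ltW Tt] := leP t T; first by rewrite BP ?orbT// t0.
by rewrite (ltW (TP p pM t Tt)).
Qed.
End Uniform_flow.

(** * Right derivatives and primitives *)

Section Right_derivative.
Variable R : realType.
Notation V := 'rV[R]_2.
Implicit Types (t s d e h L K T B M a b r : R) (W : normedModType R).

Definition rder W (f : R -> W) t (v : W) := forall e, 0 < e ->
  \forall h \near 0^'+, `|f (t + h) - f t - h *: v| <= e * h.

Lemma rder_bound W (f : R -> W) t v : rder f t v ->
  \forall h \near 0^'+, `|f (t + h) - f t| <= (`|v| + 1) * h.
Proof.
move=> fv; apply: filterS2 (nbhs_right_gt 0) (fv 1 ltr01) => h h0 H.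
have := ler_normD (f (t + h) - f t - h *: v) (h *: v).
by rewrite subrK normrZ (gtr0_norm h0); lra.
Qed.

Lemma rderB (f g : R -> V) t v w : rder f t v -> rder g t w ->
  rder (fun s => f s - g s) t (v - w).
Proof.
move=> fv gw e e0; have e2 : 0 < e / 2 by rewrite divr_gt0.
apply: filterS2 (fv _ e2) (gw _ e2) => h H1 H2.
have -> : f (t + h) - g (t + h) - (f t - g t) - h *: (v - w) =
    (f (t + h) - f t - h *: v) - (g (t + h) - g t - h *: w).
  by apply/rowP => i; rewrite !mxE; ring.
by have := ler_normB (f (t + h) - f t - h *: v) (g (t + h) - g t - h *: w); lra.
Qed.

Lemma rderZ (a : R -> R) (f : R -> V) t b v : rder (a : R -> R^o) t b -> rder f t v ->
  rder (fun s => a s *: f s) t (b *: f t + a t *: v).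
Proof.
move=> ab fv e e0.
pose K := `|f t| + `|a t| + 1.
have K0 : 0 < K by rewrite ltr_wpDl// addr_ge0.
have e2 : 0 < e / (2 * K) by rewrite divr_gt0// mulr_gt0.
near=> h.
have h0 : 0 < h by near: h; exact: nbhs_right_gt.
have H1 : `|a (t + h) - a t - h * b| <= e / (2 * K) * h by near: h; exact: ab.
have H2 : `|f (t + h) - f t - h *: v| <= e / (2 * K) * h by near: h; exact: fv.
have H3 : `|a (t + h) - a t| <= (`|b| + 1) * h.
  by near: h; exact: (@rder_bound R^o).
have H4 : `|f (t + h) - f t| <= (`|v| + 1) * h by near: h; exact: rder_bound.
have H5 : (`|b| + 1) * (`|v| + 1) * h <= e / 2.
  rewrite mulrC -ler_pdivlMr ?mulr_gt0// ?ltr_wpDl//; apply: ltW; near: h.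
  by apply: nbhs_right_lt; rewrite divr_gt0 ?divr_gt0// mulr_gt0// ltr_wpDl.
have -> : a (t + h) *: f (t + h) - a t *: f t - h *: (b *: f t + a t *: v) =
   (a (t + h) - a t - h * b) *: f t + a t *: (f (t + h) - f t - h *: v) +
   (a (t + h) - a t) *: (f (t + h) - f t).
  by apply/rowP => i; rewrite !mxE; ring.
apply: le_trans (ler_normD _ _) _.
have : `|(a (t + h) - a t) *: (f (t + h) - f t)| <= e / 2 * h.
  rewrite normrZ; apply: le_trans (ler_pM _ _ H3 H4) _ => //.
  by rewrite mulrACA mulrA; apply: ler_wpM2r; [exact: ltW|rewrite mulrC mulrA in H5 *; lra].
have : `|(a (t + h) - a t - h * b) *: f t + a t *: (f (t + h) - f t - h *: v)| <= e / 2 * h.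
  apply: le_trans (ler_normD _ _) _; rewrite !normrZ.
  apply: (@le_trans _ _ (e / (2 * K) * h * `|f t| + `|a t| * (e / (2 * K) * h))).
    by rewrite lerD// ?ler_wpM2r// ler_wpM2l.
  rewrite [`|a t| * _]mulrC -mulrDr mulrAC ler_wpM2r ?(ltW h0)//.
  rewrite (_ : e / (2 * K) * _ = e / 2 * ((`|f t| + `|a t|) / K)); last by field; rewrite gt_eqF.
  have e20 : 0 <= e / 2 by rewrite ltW// divr_gt0.
  by rewrite ler_piMr// ler_pdivrMr// mul1r /K lerDl.
lra.
Unshelve. all: end_near. Qed.
Lemma expR_quadratic r : `|r| <= 1 / 2 -> `|expR r - 1 - r| <= 2 * r ^+ 2.
Proof.
rewrite ler_norml => /andP[r1 r2].
have h1 := expR_ge1Dx r; have h2 := expR_ge1Dx (- r).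
have e0 := expR_gt0 r; have eN := expRN r.
have E : expR r * expR (- r) = 1 by rewrite eN divff// gt_eqF.
have r20 := sqr_ge0 r.
rewrite ler_norml; apply/andP; split; first by lra.
have : expR r * (1 - r) <= 1 by rewrite -[leRHS]E ler_wpM2l// ltW.
nra.
Qed.

Lemma rder_expR (f : R -> R) t b : rder (f : R -> R^o) t b ->
  rder ((fun s => expR (f s)) : R -> R^o) t (b * expR (f t)).
Proof.
move=> fb e e0; set E := expR (f t); have E0 : 0 < E by exact: expR_gt0.
pose K := `|b| + 1; have K0 : 0 < K by rewrite ltr_wpDl.
have e2 : 0 < e / (2 * E) by rewrite divr_gt0// mulr_gt0.
near=> h.
have h0 : 0 < h by near: h; exact: nbhs_right_gt.
have H1 : `|f (t + h) - f t - h * b| <= e / (2 * E) * h by near: h; exact: fb.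
have H2 : `|f (t + h) - f t| <= K * h by near: h; exact: (@rder_bound R^o).
have Kh : K * h <= 1 / 2.
  rewrite mulrC -ler_pdivlMr//; apply: ltW; near: h.
  by apply: nbhs_right_lt; rewrite !divr_gt0.
have Kh2 : E * (2 * K ^+ 2) * h <= e / 2.
  rewrite mulrC -ler_pdivlMr; last by rewrite !mulr_gt0// exprn_gt0.
  apply: ltW; near: h; apply: nbhs_right_lt; rewrite !divr_gt0//.
  by rewrite !mulr_gt0// exprn_gt0.
set r := f (t + h) - f t in H1 H2.
have -> : f (t + h) = f t + r by rewrite /r [RHS]addrC subrK.
rewrite expRD -/E.
have q := expR_quadratic (le_trans H2 Kh).
have -> : E * expR r - E - h *: (b * E : R^o) = E * (expR r - 1 - r) + E * (r - h * b).
  by rewrite /GRing.scale/=; ring.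
apply: le_trans (ler_normD _ _) _; rewrite !normrM (gtr0_norm E0).
have r2 : r ^+ 2 <= K ^+ 2 * h ^+ 2.
  by rewrite -exprMn -[leLHS]real_normK ?num_real// lerXn2r// ?nnegrE// mulr_ge0 ?ltW.
have s1 : E * `|expR r - 1 - r| <= e / 2 * h.
  apply: le_trans (ler_wpM2l (ltW E0) q) _.
  have := ler_wpM2r (ltW h0) Kh2; nra.
have s2 : E * `|r - h * b| <= e / 2 * h.
  apply: le_trans (ler_wpM2l (ltW E0) H1) _.
  by rewrite le_eqVlt; apply/orP; left; apply/eqP; field; rewrite gt_eqF.
lra.
Unshelve. all: end_near. Qed.

Lemma jac_le (F : V -> V) y v : `|jac F y v| <= (`|'D_'e_0 F y| + `|'D_'e_1 F y|) * `|v|.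
Proof.
rewrite /jac; move: ('D_'e_0 F y) ('D_'e_1 F y) => D0 D1.
apply: le_trans (ler_normD _ _) _; rewrite !normrZ mulrDl.
by apply: lerD; rewrite mulrC ler_wpM2l// coord_le_norm.
Qed.

Lemma jacZD (F : V -> V) y a b v w :
  jac F y (a *: v + b *: w) = a *: jac F y v + b *: jac F y w.
Proof.
rewrite /jac; move: ('D_'e_0 F y) ('D_'e_1 F y) => D0 D1.
by apply/rowP => i; rewrite !mxE; ring.
Qed.

Lemma rder_comp (F : V -> V) (y : R -> V) t v : quadratic_remainder F -> rder y t v ->
  rder (F \o y) t (jac F (y t) v).
Proof.
move=> qF yv e e0; have [C C0 CP] := qF (`|y t| + 1).
pose K := `|v| + 1; have K0 : 0 < K by rewrite ltr_wpDl.
pose J := `|'D_'e_0 F (y t)| + `|'D_'e_1 F (y t)| + 1.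
have J0 : 0 < J by rewrite ltr_wpDl// addr_ge0.
have e2 : 0 < e / (2 * J) by rewrite divr_gt0// mulr_gt0.
have C1 : 0 < C + 1 by rewrite ltr_wpDl.
near=> h.
have h0 : 0 < h by near: h; exact: nbhs_right_gt.
have H1 : `|y (t + h) - y t - h *: v| <= e / (2 * J) * h by near: h; exact: yv.
have H2 : `|y (t + h) - y t| <= K * h by near: h; exact: rder_bound.
have Kh : K * h <= 1.
  rewrite mulrC -ler_pdivlMr//; apply: ltW; near: h.
  by apply: nbhs_right_lt; rewrite !divr_gt0.
have Kh2 : (C + 1) * K ^+ 2 * h <= e / 2.
  rewrite mulrC -ler_pdivlMr; last by rewrite !mulr_gt0// exprn_gt0.
  apply: ltW; near: h; apply: nbhs_right_lt; rewrite !divr_gt0//.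
  by rewrite !mulr_gt0// exprn_gt0.
have yM : `|y (t + h)| <= `|y t| + 1.
  by have := ler_normD (y (t + h) - y t) (y t); rewrite subrK; lra.
have q := CP (y (t + h)) (y t) yM ltac:(by rewrite lerDl).
have -> : (F \o y) (t + h) - (F \o y) t - h *: jac F (y t) v =
    (F (y (t + h)) - F (y t) - jac F (y t) (y (t + h) - y t)) +
    jac F (y t) (y (t + h) - y t - h *: v).
  have := jacZD F (y t) 1 (- h) (y (t + h) - y t) v.
  rewrite !scale1r !scaleNr => ->; rewrite /=.
  by rewrite [RHS]addrA subrK.
apply: le_trans (ler_normD _ _) _.
have s1 : C * `|y (t + h) - y t| ^+ 2 <= e / 2 * h.
  have : `|y (t + h) - y t| ^+ 2 <= (K * h) ^+ 2.
    by rewrite lerXn2r// ?nnegrE// mulr_ge0 ?ltW.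
  have := ler_wpM2r (ltW h0) Kh2; have : 0 <= K ^+ 2 * h ^+ 2 by rewrite mulr_ge0 ?exprn_ge0// ltW.
  rewrite exprMn; nra.
have s2 : `|jac F (y t) (y (t + h) - y t - h *: v)| <= e / 2 * h.
  apply: le_trans (jac_le _ _ _) _.
  apply: (@le_trans _ _ (J * (e / (2 * J) * h))).
    by apply: ler_pM => //; rewrite ?addr_ge0// /J lerDl.
  by rewrite le_eqVlt; apply/orP; left; apply/eqP; field; rewrite gt_eqF.
lra.
Unshelve. all: end_near. Qed.

Lemma solves_rder X T (q : R -> V) t : solves id X X T q -> 0 < t < T -> rder q t (X (q t)).
Proof.
move=> [_ sq] t0T e e0; apply: filterS (sq t t0T e e0) => h.
have -> : id (t + h) - id t = h by rewrite /= addrAC subrr add0r.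
by rewrite subrr scale0r subr0.
Qed.

Section Primitive.
Let one : R -> R := fun=> 1.
Let switching_one : switching one.
Proof. by split; [exact: measurable_cst|move=> t _; rewrite ler01 lexx]. Qed.

(** Giving g to both modes makes the weights add up to 1. *)
Definition primitive (g : R -> R) : R -> R := mix_int (fun=> 1) g g.

Lemma primitive0 g : primitive g 0 = 0.
Proof. exact: mix_int0. Qed.

Lemma primitive_near T g t s a e : 0 <= t -> t <= s -> s <= T ->
  {within `[0, T], continuous g} -> (forall r, t <= r <= s -> `|g r - a| <= e) ->
  `|primitive g s - primitive g t - a * (s - t)| <= e * (s - t).
Proof.
move=> t0 ts sT cg ga.
have := @mix_int_near R one switching_one T g g t s a a e t0 ts sT cg cg.
set D := _ - mode_time one t; rewrite -/(primitive g s) -/(primitive g t).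
rewrite (_ : _ - _ - _ - _ = primitive g s - primitive g t - a * (s - t)); last by ring.
by apply=> r rts; split; exact: ga.
Qed.

Lemma primitive_continuous T g : {within `[0, T], continuous g} ->
  {within `[0, T], continuous (primitive g)}.
Proof.
move=> cg; have : bounded_set (g @` `[0, T]).
  exact/compact_bounded/continuous_compact/segment_compact.
move=> [B [_ BP]]; have B1 : B < Num.max B 0 + 1.
  by apply: (@le_lt_trans _ _ (Num.max B 0)); rewrite ?le_max ?lexx// ltrDl.
apply: (@lipschitz_within _ R^o _ (Num.max B 0 + 1)).
  by rewrite addr_ge0// le_max lexx orbT.
move=> t s t0 ts sT.
have := @primitive_near T g t s 0 (Num.max B 0 + 1) t0 ts sT cg.
rewrite mul0r subr0; apply => r /andP[tr rs]; rewrite subr0.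
by apply: (BP _ B1); exists r => //; rewrite /= in_itv/=; apply/andP; split; lra.
Qed.

Lemma primitive_rder T g t : {within `[0, T], continuous g} -> 0 < t < T ->
  rder (primitive g : R -> R^o) t (g t).
Proof.
move=> cg /andP[t0 tT] e e0.
have tTT : 0 <= t <= T by rewrite !ltW.
have /(@within_continuousP R R^o) /(_ t tTT e e0)[d d0 dP] := cg.
near=> h.
have h0 : 0 < h by near: h; exact: nbhs_right_gt.
have hd : h < d by near: h; exact: nbhs_right_lt.
have hT : h < T - t by near: h; apply: nbhs_right_lt; rewrite subr_gt0.
have := @primitive_near T g t (t + h) (g t) e (ltW t0).
rewrite [t + h - t]addrAC subrr add0r [h *: _]mulrC; apply => //; try lra.
move=> r /andP[tr rh]; apply/ltW/dP; first by apply/andP; split; lra.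
by rewrite ger0_norm; lra.
Unshelve. all: end_near. Qed.
End Primitive.
End Right_derivative.

(** * The bracket in the basis of the two fields *)

Lemma closed_norm_ge (R : realType) (W : normedModType R) (r : R) : closed [set x : W | r <= `|x|].
Proof.
have -> : [set x : W | r <= `|x|] = Num.norm @^-1` [set a : R | r <= a] by [].
apply: preimage_closed; last exact: closed_ge.
by move=> x _; exact: norm_continuous.
Qed.

Lemma continuous_lincomb (R : realType) (T : topologicalType) (W : normedModType R)
    (a b : T -> R) (f g : T -> W) : continuous a -> continuous b ->
  continuous f -> continuous g -> continuous (fun y => a y *: f y + b y *: g y).
Proof.
move=> ca cb cf cg y; apply: cvgD; apply: cvgZ.
- exact: ca.
- exact: cf.
- exact: cb.
- exact: cg.
Qed.

Lemma continuous_sub (R : realType) (T : topologicalType) (W : normedModType R)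
    (f g : T -> W) : continuous f -> continuous g -> continuous (fun y => f y - g y).
Proof. by move=> cf cg y; apply: cvgB; [exact: cf|exact: cg]. Qed.

Section Bracket_coefficients.
Variable R : realType.
Notation V := 'rV[R]_2.
Implicit Types (t s d e h L K T B M a b r : R) (w x y z : V).

Definition det2 x y : R := x 0 0 * y 0 1 - x 0 1 * y 0 0.

Lemma cramer2 w x y : det2 x y != 0 ->
  w = (det2 w y / det2 x y) *: x + (det2 x w / det2 x y) *: y.
Proof.
rewrite /det2 => D0; apply/rowP => i; rewrite !mxE.
have [->|i0] := eqVneq i 0; first by field.
have -> : i = 1 by apply/val_inj; case: i i0 => -[|[|]].
by field.
Qed.

Variables X Y : V -> V.
Hypotheses (cX : continuous X) (cY : continuous Y).
Hypotheses (cDX : forall i, continuous ('D_'e_i X)) (cDY : forall i, continuous ('D_'e_i Y)).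
Hypothesis det_neq0 : forall y, y != 0 -> det2 (X y) (Y y) != 0.

Definition bracket y : V := jac Y y (X y) - jac X y (Y y).
Definition coefX y : R := det2 (bracket y) (Y y) / det2 (X y) (Y y).
Definition coefY y : R := det2 (X y) (bracket y) / det2 (X y) (Y y).

(** Cramer's rule; the coordinates are continuous off the origin, where X and Y
    are independent. *)
Lemma bracketE y : y != 0 -> bracket y = coefX y *: X y + coefY y *: Y y.
Proof. by move=> y0; apply: cramer2; exact: det_neq0. Qed.

Lemma continuous_coord (F : V -> V) i : continuous F -> continuous (fun y => F y 0 i).
Proof.
by move=> cF y; apply: (cvg_comp F (fun v : V => v 0 i) (cF y)); exact: coord_continuous.
Qed.

Lemma continuous_det2 (F G : V -> V) : continuous F -> continuous G ->
  continuous (fun y => det2 (F y) (G y)).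
Proof.
move=> cF cG y; have f i := @continuous_coord F i cF y.
have g i := @continuous_coord G i cG y.
exact: (cvgB (cvgM (f 0) (g 1)) (cvgM (f 1) (g 0))).
Qed.

Lemma continuous_jac (F G : V -> V) : continuous G ->
  (forall i, continuous ('D_'e_i F)) -> continuous (fun y => jac F y (G y)).
Proof.
by move=> cG cDF; apply: continuous_lincomb => //; exact: continuous_coord.
Qed.

Lemma continuous_bracket : continuous bracket.
Proof.
exact: continuous_sub (continuous_jac cX cDY) (continuous_jac cY cDX).
Qed.

Lemma continuous_coefX y : y != 0 -> {for y, continuous coefX}.
Proof.
move=> y0; apply: (cvgM (@continuous_det2 _ _ continuous_bracket cY y)).
exact: (cvgV (det_neq0 y0) (@continuous_det2 _ _ cX cY y)).
Qed.

Lemma continuous_coefY y : y != 0 -> {for y, continuous coefY}.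
Proof.
move=> y0; apply: (cvgM (@continuous_det2 _ _ cX continuous_bracket y)).
exact: (cvgV (det_neq0 y0) (@continuous_det2 _ _ cX cY y)).
Qed.

Lemma annulus_bounded (f : V -> R) r M : 0 < r -> (forall y, y != 0 -> {for y, continuous f}) ->
  exists2 B, 0 <= B & forall y, r <= `|y| -> `|y| <= M -> `|f y| <= B.
Proof.
move=> r0 cf.
have cM : compact ([set x : V | `|x| <= M] `&` [set x : V | r <= `|x|]).
  apply: bounded_closed_compact.
    by exists M; split; [exact: num_real|move=> N MN x /= [xM _]; rewrite (le_trans xM)// ltW].
  apply: closedI; first exact: closed_norm_le.
  exact: closed_norm_ge.
have : bounded_set (f @` ([set x : V | `|x| <= M] `&` [set x : V | r <= `|x|])).
  apply/compact_bounded/continuous_compact => //.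
  apply: continuous_in_subspaceT => y; rewrite inE => -[_ /= ry]; apply: cf.
  by rewrite -normr_gt0 (lt_le_trans r0).
move=> [B [_ BP]]; have B1 : B < Num.max B 0 + 1.
  by apply: (@le_lt_trans _ _ (Num.max B 0)); rewrite ?le_max ?lexx// ltrDl.
exists (Num.max B 0 + 1); first by rewrite addr_ge0// le_max lexx orbT.
by move=> y ry yM; apply: (BP _ B1); exists y.
Qed.
End Bracket_coefficients.

(** * Linearisation of a flow along an orbit *)

Section Variation.
Variable R : realType.
Notation V := 'rV[R]_2.
Implicit Types (t s d e h L K T B M a b r k : R) (w x y z v : V).

Lemma rder_cst a t : rder ((fun=> a) : R -> R^o) t 0.
Proof.
move=> e e0; apply: filterS (nbhs_right_gt 0) => h h0.
by rewrite subrr scaler0 subr0 normr0 mulr_ge0// ltW.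
Qed.

(** Equality of the derivative of c Y - A X along an orbit of X, on the left, and
    of the linearisation DX applied to c Y - A X, when c' = - n c and A' = m c.
    The three vectors DXX, DXY, DYX stand for DX X, DX Y, DY X. *)
Lemma cancel_bracket (Xy Yy DXX DXY DYX : V) (m n c A : R) :
  DYX - DXY = m *: Xy + n *: Yy ->
  ((- n * c) *: Yy + c *: DYX) - ((m * c) *: Xy + A *: DXX) = c *: DXY - A *: DXX.
Proof.
move=> H; have -> : DYX = DXY + (m *: Xy + n *: Yy) by rewrite -H addrC subrK.
by apply/rowP => i; rewrite !mxE; ring.
Qed.

Variables X Y : V -> V.
Hypotheses (cX : continuous X) (cY : continuous Y).
Hypotheses (cDX : forall i, continuous ('D_'e_i X)) (cDY : forall i, continuous ('D_'e_i Y)).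
Hypothesis det_neq0 : forall y, y != 0 -> det2 (X y) (Y y) != 0.
Hypotheses (lX : locally_lipschitz X) (qX : quadratic_remainder X) (qY : quadratic_remainder Y).
Variable phi : R -> V -> V.
Hypothesis fX : stable_flow X phi.

Lemma flow_dist_le M : exists2 L, 0 <= L & forall x x' t, 0 <= t ->
  (forall s, 0 <= s -> `|phi s x| <= M) -> (forall s, 0 <= s -> `|phi s x'| <= M) ->
  `|phi t x' - phi t x| <= `|x' - x| * expR (L * t).
Proof.
have [L L1 LP] := lX M; exists (L + 1); first by rewrite addr_ge0// (le_trans ler01).
move=> x x' t t0 xM x'M.
have := @solves_dist _ id X X L t (phi ^~ x') (phi ^~ x) (@clock_id R) (le_trans ler01 L1) t0
  (flow_solves fX x' t) (flow_solves fX x t).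
rewrite !(flow_start fX); apply => s /andP[s0 st].
by split; apply: LP; [exact: x'M|exact: xM|exact: x'M|exact: xM].
Qed.

Section Along_orbit.
Variables (x : V) (s : R).
Hypotheses (s0 : 0 <= s) (x0 : forall t, 0 <= t <= s -> phi t x != 0).
Let y t := phi t x.

Let cy : {within `[0, s], continuous y} := (flow_solves fX x s).1.

Lemma continuous_along (f : V -> R) : (forall z, z != 0 -> {for z, continuous f}) ->
  {within `[0, s], continuous (f \o y)}.
Proof.
move=> cf; apply/subspace_continuousP => t; rewrite /= in_itv/= => ts.
have /subspace_continuousP /(_ t) := cy; rewrite /= in_itv/= ts => /(_ isT) cyt.
exact: (cvg_comp _ _ cyt (cf (y t) (x0 ts))).
Qed.

(** The image of Y x under the differential of phi t is
    transportY t *: Y (y t) - transportX t *: X (y t). The weights solve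
    c' = - n c, c 0 = 1 and A' = m c, A 0 = 0 with m and n the coordinates of the
    bracket along the orbit; the weight of Y, an exponential, is positive. *)
Definition transportY : R -> R := fun t => expR (primitive (fun r => - coefY X Y (y r)) t).
Definition transportX : R -> R := primitive (fun r => coefX X Y (y r) * transportY r).

Let cn : {within `[0, s], continuous (fun r => - coefY X Y (y r))}.
Proof.
by move=> t; apply: cvgN; exact: (continuous_along (continuous_coefY cX cY cDX cDY det_neq0)).
Qed.

Let cc : {within `[0, s], continuous transportY}.
Proof.
have cp := primitive_continuous cn => t.
exact: (@cvg_comp _ _ _ _ expR _ _ _ (cp t) (@continuous_expR _ _)).
Qed.

Let cm : {within `[0, s], continuous (fun r => coefX X Y (y r) * transportY r)}.
Proof.
move=> t; apply: cvgM; last exact: cc.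
exact: (continuous_along (continuous_coefX cX cY cDX cDY det_neq0)).
Qed.

Let cA : {within `[0, s], continuous transportX} := primitive_continuous cm.

Lemma transportY_bound n0 t : 0 <= n0 -> 0 <= t <= s ->
  (forall r, 0 <= r <= s -> `|coefY X Y (y r)| <= n0) ->
  expR (- (n0 * s)) <= transportY t <= expR (n0 * s).
Proof.
move=> n00 /andP[t0 ts] nn; rewrite /transportY !ler_expR -ler_norml.
have := @primitive_near R s (fun r => - coefY X Y (y r)) 0 t 0 n0 (lexx 0) t0 ts cn.
rewrite primitive0 mul0r !subr0 => /(_ _)/le_trans; apply; last by rewrite ler_wpM2l.
by move=> r /andP[r0 rt]; rewrite subr0 normrN nn// r0 (le_trans rt).
Qed.

Lemma transportX_bound m0 K : (forall r, 0 <= r <= s -> `|coefX X Y (y r)| <= m0) ->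
  (forall r, 0 <= r <= s -> `|transportY r| <= K) -> `|transportX s| <= m0 * K * s.
Proof.
move=> mm KK.
have := @primitive_near R s (fun r => coefX X Y (y r) * transportY r) 0 s 0
  (m0 * K) (lexx 0) s0 (lexx s) cm.
rewrite primitive0 mul0r !subr0; apply => r rs.
by rewrite subr0 normrM ler_pM// ?mm ?KK.
Qed.

(** The defect f of the linear approximation solves the linearised equation up
    to the quadratic remainder of X. *)
Lemma transport_rder x' k t : 0 < t < s ->
  let f r := (phi r x' - y r) - k *: (transportY r *: Y (y r) - transportX r *: X (y r)) in
  rder f t ((X (phi t x') - X (y t) - jac X (y t) (phi t x' - y t)) + jac X (y t) (f t)).
Proof.
move=> t0s f; have /andP[t0 ts] := t0s.
have ry : rder y t (X (y t)) := solves_rder (flow_solves fX x s) t0s.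
have rz : rder (phi ^~ x') t (X (phi t x')) := solves_rder (flow_solves fX x' s) t0s.
have rc : rder (transportY : R -> R^o) t (- coefY X Y (y t) * transportY t) :=
  rder_expR (primitive_rder cn t0s).
have rA : rder (transportX : R -> R^o) t (coefX X Y (y t) * transportY t) := primitive_rder cm t0s.
have rf := rderB (rderB rz ry) (rderZ (@rder_cst k t)
   (rderB (rderZ rc (rder_comp qY ry)) (rderZ rA (rder_comp qX ry)))).
have yt0 : y t != 0 by apply: x0; rewrite !ltW.
have bE := bracketE det_neq0 yt0; rewrite /bracket in bE.
rewrite scale0r add0r (cancel_bracket _ _ _ bE) in rf.
rewrite (_ : _ + jac X (y t) (f t) = X (phi t x') - X (y t) - k *:
  (transportY t *: jac X (y t) (Y (y t)) - transportX t *: jac X (y t) (X (y t))))//.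
have := jacZD X (y t) 1 (- k) (phi t x' - y t) (transportY t *: Y (y t) - transportX t *: X (y t)).
rewrite !scale1r scaleNr -/(f t) => ->.
have := jacZD X (y t) (transportY t) (- transportX t) (Y (y t)) (X (y t)).
rewrite !scaleNr => ->.
by rewrite addrA subrK.
Qed.

Lemma transport_continuous x' k :
  {within `[0, s], continuous (fun r =>
    (phi r x' - y r) - k *: (transportY r *: Y (y r) - transportX r *: X (y r)))}.
Proof.
move=> t; apply: cvgB.
  by apply: cvgB; [exact: (flow_solves fX x' s).1|exact: cy].
apply: cvgZ; first exact: cvg_cst.
apply: cvgB; apply: cvgZ.
- exact: cc.
- exact: (within_continuous_comp cY cy).
- exact: cA.
- exact: (within_continuous_comp cX cy).
Qed.
End Along_orbit.

(** First-order expansion of phi s x' around x in the direction Y x, up to a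
    quadratic error, from Gronwall's estimate for the defect. All constants are
    uniform for orbits in the annulus of radii r and M and times at most S; the
    bound on A vanishes with s. *)
Lemma orbit_variation (M r S : R) : 0 < r -> 0 <= S -> exists K m0 C, [/\ 1 <= K, 0 <= m0, 0 <= C &
  forall x s, 0 <= s <= S -> (forall t, 0 <= t -> `|phi t x| <= M) ->
    (forall t, 0 <= t <= s -> r <= `|phi t x|) ->
  exists c A, [/\ K^-1 <= c <= K, `|A| <= m0 * s & forall x' k,
    (forall t, 0 <= t -> `|phi t x'| <= M) ->
    `|phi s x' - phi s x - k *: (c *: Y (phi s x) - A *: X (phi s x))| <=
      C * (`|x' - x - k *: Y x| + `|x' - x| ^+ 2)]].
Proof.
move=> r0 S0.
have [m0 m00 m0P] := annulus_bounded M r0 (continuous_coefX cX cY cDX cDY det_neq0).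
have [n0 n00 n0P] := annulus_bounded M r0 (continuous_coefY cX cY cDX cDY det_neq0).
have [B0 B0P] := continuous_ball_bounded M (@cDX 0).
have [B1 B1P] := continuous_ball_bounded M (@cDX 1).
pose L' := Num.max 0 (B0 + B1); have L'0 : 0 <= L' by rewrite le_max lexx.
have [L L0 LP] := flow_dist_le M.
have [C2 C20 C2P] := qX M.
pose E := expR (L * S) ^+ 2; have E0 : 0 <= E by rewrite exprn_ge0// ltW// expR_gt0.
pose K := expR (n0 * S); pose G := expR ((L' + 1) * S).
have G0 : 0 < G by exact: expR_gt0.
exists K, (m0 * K), (G * (1 + C2 * E)); split.
- by rewrite -expR0 ler_expR mulr_ge0.
- by rewrite mulr_ge0// ltW// expR_gt0.
- by rewrite mulr_ge0 ?(ltW G0)// addr_ge0// mulr_ge0.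
move=> x s /andP[s0 sS] xM xr.
have x0 t : 0 <= t <= s -> phi t x != 0.
  by move=> ts; rewrite -normr_gt0 (lt_le_trans r0)// xr.
have nn t : 0 <= t <= s -> `|coefY X Y (phi t x)| <= n0.
  by move=> ts; have /andP[t0 _] := ts; apply: n0P; [exact: xr|exact: xM].
have mm t : 0 <= t <= s -> `|coefX X Y (phi t x)| <= m0.
  by move=> ts; have /andP[t0 _] := ts; apply: m0P; [exact: xr|exact: xM].
have cb t : 0 <= t <= s -> K^-1 <= transportY x t <= K.
  move=> ts; have /andP[h1 h2] := transportY_bound x0 n00 ts nn.
  apply/andP; split; last by apply: le_trans h2 _; rewrite ler_expR ler_wpM2l.
  by apply: le_trans h1; rewrite -expRN ler_expR lerN2 ler_wpM2l.
have cK t : 0 <= t <= s -> `|transportY x t| <= K.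
  by move=> ts; have /andP[_ h] := cb t ts; rewrite ger0_norm// ltW// expR_gt0.
exists (transportY x s), (transportX x s); split; first by apply: cb; rewrite s0 lexx.
  exact: (transportX_bound s0 x0 mm cK).
move=> x' k x'M.
pose f t := (phi t x' - phi t x) -
  k *: (transportY x t *: Y (phi t x) - transportX x t *: X (phi t x)).
have f0 : f 0 = x' - x - k *: Y x.
  rewrite /f !(flow_start fX) /transportY /transportX !primitive0 expR0 scale1r scale0r subr0//.
have := @gronwall R _ f L' (C2 * (E * `|x' - x| ^+ 2)) s L'0 _ s0
  (@transport_continuous x s x0 x' k) _.
rewrite f0 -/(f s) => H.
apply: (le_trans (H _ _)).
- by rewrite !mulr_ge0.
- move=> t t0s e e0; have /andP[t0 ts] := t0s.
  apply: filterS2 (nbhs_right_gt 0) (transport_rder x0 x' k t0s e0) => h h0.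
  set D := _ + jac X _ _ => Hr.
  have HD : `|D| <= L' * `|f t| + C2 * (E * `|x' - x| ^+ 2).
    apply: le_trans (ler_normD _ _) _; rewrite addrC lerD//.
      apply: le_trans (jac_le _ _ _) _; rewrite ler_wpM2r//.
      rewrite /L' le_max; apply/orP; right.
      have xt := xM t (ltW t0).
      exact: lerD (B0P _ xt) (B1P _ xt).
    apply: le_trans (C2P _ _ (x'M t (ltW t0)) (xM t (ltW t0))) _.
    have hd : `|phi t x' - phi t x| <= expR (L * S) * `|x' - x|.
      rewrite mulrC; apply: le_trans (LP _ _ _ (ltW t0) xM x'M) _.
      by rewrite ler_wpM2l// ler_expR ler_wpM2l// (le_trans (ltW ts)).
    by rewrite ler_wpM2l// /E -exprMn lerXn2r// nnegrE// (le_trans _ hd).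
  have := ler_normD (f (t + h) - f t - h *: D) (h *: D); rewrite subrK normrZ (gtr0_norm h0).
  have := ler_wpM2l (ltW h0) HD.
  rewrite -/(f t) -/(f (t + h)) in Hr; lra.
have Gs : expR ((L' + 1) * s) <= G by rewrite ler_expR ler_wpM2l// addr_ge0.
have n1 := normr_ge0 (x' - x - k *: Y x); have n2 : 0 <= `|x' - x| ^+ 2 by rewrite exprn_ge0.
have CE : 0 <= C2 * E by rewrite mulr_ge0.
apply: (@le_trans _ _ ((`|x' - x - k *: Y x| + C2 * (E * `|x' - x| ^+ 2)) * G)).
  by apply: ler_wpM2l => //; apply: addr_ge0 => //; rewrite mulrA mulr_ge0.
have : 0 <= C2 * E * `|x' - x - k *: Y x| * G by rewrite !mulr_ge0// ltW.
have : 0 <= `|x' - x| ^+ 2 * G by rewrite mulr_ge0// ltW.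
lra.
Qed.
End Variation.

(** * One step along the composed flows *)

Section Flow_speed.
Variable R : realType.
Notation V := 'rV[R]_2.
Implicit Types (t s d e h L K T B M a b r k l : R) (w x y z v : V).
Variables (X : V -> V) (phi : R -> V -> V).
Hypotheses (lX : locally_lipschitz X) (fX : stable_flow X phi).

Lemma flow_speed M : exists2 B, 0 <= B & forall x, (forall s, 0 <= s -> `|phi s x| <= M) ->
  forall s s', 0 <= s -> 0 <= s' -> `|phi s' x - phi s x| <= B * `|s' - s|.
Proof.
have [B B0 BP] := locally_lipschitz_bounded M lX; exists B => // x xM.
have fwd s s' : 0 <= s -> s <= s' -> `|phi s' x - phi s x| <= B * (s' - s).
  move=> s0 ss'.
  have := @solves_step R _ _ _ s' _ 0 0 s s' B (@clock_id R) (flow_solves fX x s') s0 ss' (lexx s').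
  rewrite !scaler0 !subr0; apply => t /andP[st _]; rewrite subr0.
  by split; apply/BP/xM/(le_trans s0).
move=> s s' s0 s'0; have [ss'|/ltW s's] := leP s s'.
  by rewrite [`|s' - s|]ger0_norm ?subr_ge0// fwd.
by rewrite distrC (distrC s') [`|s - s'|]ger0_norm ?subr_ge0// fwd.
Qed.

(** The velocity X (phi s x) is a Lipschitz function of s. *)
Lemma flow_quadratic M : exists2 C, 0 <= C & forall x, (forall s, 0 <= s -> `|phi s x| <= M) ->
  forall s s', 0 <= s -> 0 <= s' ->
  `|phi s' x - phi s x - (s' - s) *: X (phi s x)| <= C * `|s' - s| ^+ 2.
Proof.
have [B B0 BP] := flow_speed M; have [L L1 LP] := lX M.
have L0 : 0 <= L := le_trans ler01 L1.
exists (2 * (L * B)); first by rewrite !mulr_ge0.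
move=> x xM.
have speed s s' : 0 <= s -> 0 <= s' -> `|X (phi s' x) - X (phi s x)| <= L * B * `|s' - s|.
  move=> s0 s'0; apply: le_trans (LP _ _ (xM _ s'0) (xM _ s0)) _.
  by rewrite -mulrA ler_wpM2l// BP.
have fwd s s' : 0 <= s -> s <= s' ->
    `|phi s' x - phi s x - (s' - s) *: X (phi s x)| <= L * B * (s' - s) ^+ 2.
  move=> s0 ss'.
  have := @solves_step R _ _ _ s' _ (X (phi s x)) (X (phi s x)) s s' (L * B * (s' - s))
    (@clock_id R) (flow_solves fX x s') s0 ss' (lexx s').
  rewrite /= subrr scale0r subr0 expr2 mulrA; apply => t /andP[st ts'].
  have t0 := le_trans s0 st.
  have := speed s t s0 t0; rewrite ger0_norm ?subr_ge0// => H.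
  have : L * B * (t - s) <= L * B * (s' - s) by rewrite ler_wpM2l ?mulr_ge0// lerD2r.
  by split; apply: (le_trans H).
move=> s s' s0 s'0; have [ss'|/ltW s's] := leP s s'.
  rewrite [`|s' - s|]ger0_norm ?subr_ge0//; apply: le_trans (fwd _ _ s0 ss') _.
  by rewrite ler_wpM2r ?exprn_ge0 ?subr_ge0// mulr_natl mulr2n lerDl mulr_ge0.
have h1 := fwd _ _ s'0 s's; have h2 := speed _ _ s'0 s0.
rewrite (distrC s') [`|s - s'|]ger0_norm ?subr_ge0// in h2 *.
have -> : phi s' x - phi s x - (s' - s) *: X (phi s x) =
  (s - s') *: (X (phi s x) - X (phi s' x)) - (phi s x - phi s' x - (s - s') *: X (phi s' x)).
  by apply/rowP => i; rewrite !mxE; ring.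
apply: le_trans (ler_normB _ _) _; rewrite normrZ ger0_norm ?subr_ge0//.
have := ler_wpM2l (_ : 0 <= s - s') h2; rewrite subr_ge0 => /(_ s's); nra.
Qed.
End Flow_speed.

Section Tangent_step.
Variable R : realType.
Notation V := 'rV[R]_2.
Implicit Types (t s d e h L K T B M a b r k l : R) (w x y z v : V).
Variables X Y : V -> V.
Hypotheses (cX : continuous X) (cY : continuous Y).
Hypotheses (cDX : forall i, continuous ('D_'e_i X)) (cDY : forall i, continuous ('D_'e_i Y)).
Hypothesis det_neq0 : forall y, y != 0 -> det2 (X y) (Y y) != 0.
Hypotheses (lX : locally_lipschitz X) (lY : locally_lipschitz Y).
Hypotheses (qX : quadratic_remainder X) (qY : quadratic_remainder Y).
Variables phi psi : R -> V -> V.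
Hypotheses (fX : stable_flow X phi) (fY : stable_flow Y psi).

(** A small displacement of phi s x in the direction l X + (1 - l) Y amounts, up
    to an error of order h ^+ 2, to replacing x by psi k x and s by s', with
    k = (1 - l) h / c and s' = s + (l + (1 - l) A / c) h. Indeed moving x along psi
    moves phi s x by k (c Y - A X). Positivity of c gives k >= 0, and s' >= 0 for
    small h because A is at most a multiple of s. The decrease of s is at most a
    multiple of k, so that s + N k grows at rate at least 1 for large N. *)
Lemma tangent_step (M r S : R) : 0 < r -> 0 <= S -> exists N C h0, [/\ 0 <= N, 0 <= C, 0 < h0 &
  forall x s, 0 <= s <= S ->
    (forall t k, 0 <= t -> 0 <= k -> `|phi t (psi k x)| <= M) ->
    (forall t, 0 <= t <= s -> r <= `|phi t x|) ->
  forall l h, 0 <= l <= 1 -> 0 <= h <= h0 -> exists s' k, [/\ 0 <= s', 0 <= k, s + h <= s' + N * k &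
    `|phi s' (psi k x) - phi s x - h *: (l *: X (phi s x) + (1 - l) *: Y (phi s x))| <=
      C * h ^+ 2]].
Proof.
move=> r0 S0.
have [K [m0 [C1 [K1 m00 C10 var]]]] :=
  @orbit_variation R X Y cX cY cDX cDY det_neq0 lX qX qY phi fX M r S r0 S0.
have [By By0 ByP] := flow_speed lY fY M; have [Cy Cy0 CyP] := flow_quadratic lY fY M.
have [Cx Cx0 CxP] := flow_quadratic lX fX M.
have [Lx Lx1 LxP] := lX M; have [L L0 LP] := flow_dist_le lX fX M.
have K0 : 0 < K := lt_le_trans ltr01 K1.
have Lx0 : 0 <= Lx := le_trans ler01 Lx1.
pose a0 := K * m0 * S; have a00 : 0 <= a0 by rewrite !mulr_ge0// ltW.
pose E := expR (L * S); have E0 : 0 < E by exact: expR_gt0.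
have Km : 0 < K * m0 + 1 by rewrite ltr_wpDl// mulr_ge0// ltW.
pose C := C1 * (Cy * K ^+ 2 + (By * K) ^+ 2) + Cx * (1 + a0) ^+ 2 + (1 + a0) * (Lx * (By * K * E)).
(* The rate of s is at least l - (1 - l) * a0 and that of k at least (1 - l) / K,
   hence the choice of N; the bound on h keeps s' nonnegative. *)
exists (K * (1 + a0)), C, (K * m0 + 1)^-1; split.
- by rewrite mulr_ge0 ?(ltW K0)// addr_ge0.
- rewrite /C !addr_ge0// !mulr_ge0 ?addr_ge0 ?mulr_ge0 ?exprn_ge0 ?addr_ge0 ?mulr_ge0//; exact: ltW.
- by rewrite invr_gt0.
move=> x s sS PM xr l h /andP[l0 l1] /andP[h0 hh].
have /andP[s0 sS'] := sS.
have xM t : 0 <= t -> `|phi t x| <= M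
  by move=> t0; have := PM t 0 t0 (lexx 0); rewrite (flow_start fY).
have yM t : 0 <= t -> `|psi t x| <= M
  by move=> t0; have := PM 0 t (lexx 0) t0; rewrite (flow_start fX).
have [c [A [/andP[cK Kc] As var']]] := var x s sS xM xr.
have c0 : 0 < c by apply: lt_le_trans cK; rewrite invr_gt0.
pose a := A / c; pose k := (1 - l) * h / c.
have l10 : 0 <= 1 - l by rewrite subr_ge0.
have lh0 : 0 <= (1 - l) * h by rewrite mulr_ge0.
have ci : c^-1 <= K by rewrite -[K]invrK lef_pV2// posrE invr_gt0.
have iK : K^-1 <= c^-1 by rewrite lef_pV2// posrE.
have ci0 : 0 < c^-1 by rewrite invr_gt0.
have k0 : 0 <= k by rewrite divr_ge0// ltW.
have kK : k <= K * h.
  apply: le_trans (ler_wpM2l lh0 ci) _; rewrite mulrC ler_wpM2l ?(ltW K0)//.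
  by rewrite ler_piMl// gerBl.
have Kk : (1 - l) * h <= K * k.
  have := ler_wpM2l (ltW K0) (ler_wpM2l lh0 iK).
  by rewrite [X in X <= _]mulrCA divff ?mulr1// gt_eqF.
have as_ : `|a| <= K * m0 * s.
  rewrite /a normrM (gtr0_norm ci0).
  by apply: le_trans (ler_pM _ _ As ci) _ => //; [exact: ltW|lra].
have aa : `|a| <= a0.
  by apply: (le_trans as_); rewrite /a0 ler_wpM2l// mulr_ge0// ltW.
pose b := l + (1 - l) * a; pose s' := s + b * h.
have ba : `|b| <= 1 + a0.
  apply: le_trans (ler_normD _ _) _; rewrite (ger0_norm l0) normrM (ger0_norm l10).
  have : (1 - l) * `|a| <= a0 by apply: le_trans aa; rewrite ler_piMl//; lra.
  lra.
have ma : - `|a| <= (1 - l) * a.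
  have := ler_norm (- a); rewrite normrN => H.
  have : (1 - l) * `|a| <= `|a| by rewrite ler_piMl//; lra.
  have := ler_wpM2l l10 H; lra.
have s'0 : 0 <= s'.
  have h1 : h * (K * m0 + 1) <= 1 by rewrite -ler_pdivlMr// div1r.
  have : - (K * m0 * s) <= b by rewrite /b; lra.
  move=> /(ler_wpM2r h0) H.
  have : s * (h * (K * m0 + 1)) <= s by rewrite ler_piMr.
  have : 0 <= s * h by rewrite mulr_ge0.
  rewrite /s'; lra.
exists s', k; split => //.
  rewrite /s'.
  have h1 : - a0 * (1 - l) <= (1 - l) * a.
    have := ler_norm (- a); rewrite normrN => H; have := ler_wpM2l l10 (le_trans H aa); lra.
  have h2 := ler_wpM2r h0 (_ : l - a0 * (1 - l) <= b).
  have {}h2 : (l - a0 * (1 - l)) * h <= b * h by apply: h2; rewrite /b; lra.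
  have h3 := ler_wpM2l (_ : 0 <= 1 + a0) Kk.
  have {}h3 : (1 + a0) * ((1 - l) * h) <= (1 + a0) * (K * k) by apply: h3; lra.
  lra.
have Kh0 : 0 <= K * h by rewrite mulr_ge0// ltW.
have ByKh0 : 0 <= By * K * h by rewrite -mulrA mulr_ge0.
set z := psi k x; set p := phi s x.
have zM t : 0 <= t -> `|phi t z| <= M by move=> t0; exact: PM.
have zx1 : `|z - x| <= By * K * h.
  have := ByP x yM 0 k (lexx 0) k0; rewrite (flow_start fY) subr0 (ger0_norm k0) => H.
  by apply: (le_trans H); rewrite -mulrA ler_wpM2l.
have zx2 : `|z - x - k *: Y x| <= Cy * K ^+ 2 * h ^+ 2.
  have := CyP x yM 0 k (lexx 0) k0; rewrite (flow_start fY) !subr0 (ger0_norm k0) => H.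
  by apply: (le_trans H); rewrite -mulrA ler_wpM2l// -exprMn lerXn2r ?nnegrE.
have E1 : `|phi s z - p - k *: (c *: Y p - A *: X p)| <=
    C1 * (Cy * K ^+ 2 + (By * K) ^+ 2) * h ^+ 2.
  apply: le_trans (var' z k zM) _; rewrite -mulrA ler_wpM2l// mulrDl lerD// -exprMn.
  by rewrite lerXn2r ?nnegrE.
have bh : `|s' - s| = `|b| * h by rewrite /s' addrAC subrr add0r normrM (ger0_norm h0).
have E2 : `|phi s' z - phi s z - (s' - s) *: X (phi s z)| <= Cx * (1 + a0) ^+ 2 * h ^+ 2.
  apply: le_trans (CxP z zM s s' s0 s'0) _; rewrite -mulrA ler_wpM2l// bh exprMn.
  by rewrite ler_wpM2r ?exprn_ge0// lerXn2r ?nnegrE// addr_ge0.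
have E3 : `|(s' - s) *: (X (phi s z) - X p)| <= (1 + a0) * (Lx * (By * K * E)) * h ^+ 2.
  rewrite normrZ bh.
  have h1 : `|X (phi s z) - X p| <= Lx * (By * K * E) * h.
    apply: le_trans (LxP _ _ (zM _ s0) (xM _ s0)) _; rewrite -mulrA ler_wpM2l//.
    rewrite (_ : By * K * E * h = By * K * h * E); last by ring.
    apply: le_trans (LP _ _ _ s0 xM zM) _; apply: ler_pM => //.
    by rewrite /E ler_expR ler_wpM2l.
  have := ler_pM (mulr_ge0 (normr_ge0 b) h0) (normr_ge0 _) (ler_wpM2r h0 ba) h1.
  by rewrite expr2; move=> H; apply: (le_trans H); lra.
have -> : phi s' z - p - h *: (l *: X p + (1 - l) *: Y p) =
   (phi s' z - phi s z - (s' - s) *: X (phi s z)) + (s' - s) *: (X (phi s z) - X p) +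
   (phi s z - p - k *: (c *: Y p - A *: X p)).
  by apply/rowP => i; rewrite !mxE /s' /b /a /k; field; rewrite gt_eqF.
apply: le_trans (ler_normD _ _) _; apply: le_trans (lerD (ler_normD _ _) (lexx _)) _.
rewrite /C; lra.
Qed.
End Tangent_step.

(** * Tracking a trajectory by the composed flows *)

Section Tracking.
Variable R : realType.
Notation V := 'rV[R]_2.
Implicit Types (t s d e h L K T B M a b r k l : R) (p w x y z v : V) (U : R -> R) (q : R -> V).
Variables X Y : V -> V.
Hypotheses (cX : continuous X) (cY : continuous Y).
Hypotheses (cDX : forall i, continuous ('D_'e_i X)) (cDY : forall i, continuous ('D_'e_i Y)).
Hypothesis det_neq0 : forall y, y != 0 -> det2 (X y) (Y y) != 0.
Hypotheses (lX : locally_lipschitz X) (lY : locally_lipschitz Y).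
Hypotheses (qX : quadratic_remainder X) (qY : quadratic_remainder Y).
Variables phi psi : R -> V -> V.
Hypotheses (fX : stable_flow X phi) (fY : stable_flow Y psi).

Lemma solves_quadratic U T q : clock U -> solves U X Y T q -> exists2 C, 0 <= C &
  forall t h, 0 <= t -> 0 <= h -> t + h <= T ->
  `|q (t + h) - q t - (U (t + h) - U t) *: X (q t) - (h - (U (t + h) - U t)) *: Y (q t)| <=
    C * h ^+ 2.
Proof.
move=> cU sq; have [M qM] := solves_bounded sq.
have [B1 B10 BX] := locally_lipschitz_bounded M lX.
have [B2 B20 BY] := locally_lipschitz_bounded M lY.
have [L1 L11 LX] := lX M; have [L2 L21 LY] := lY M.
pose B := B1 + B2; have B0 : 0 <= B by exact: addr_ge0.
pose L := L1 + L2; have L0 : 0 <= L by rewrite addr_ge0// (le_trans ler01).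
have speed t s : 0 <= t -> t <= s -> s <= T -> `|q s - q t| <= B * (s - t).
  move=> t0 ts sT.
  have := @solves_step R U X Y T q 0 0 t s B cU sq t0 ts sT.
  rewrite !scaler0 !subr0; apply => r /andP[tr rs]; rewrite !subr0.
  have rT : `|q r| <= M by apply: qM; rewrite (le_trans t0 tr) (le_trans rs sT).
  have := BX _ rT; have := BY _ rT; rewrite /B; split; lra.
exists (L * B); first by rewrite mulr_ge0.
move=> t h t0 h0 thT.
have := @solves_step R U X Y T q (X (q t)) (Y (q t)) t (t + h) (L * B * h) cU sq t0.
rewrite lerDl (_ : t + h - t = h); last by ring.
move=> /(_ h0 thT) H; rewrite expr2 mulrA; apply: H => r /andP[tr rth].
have rT : `|q r| <= M by apply: qM; rewrite (le_trans t0 tr) (le_trans rth thT).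
have tT : `|q t| <= M by apply: qM; rewrite t0 (le_trans (le_trans tr rth) thT).
have sp := speed t r t0 tr (le_trans rth thT).
have Bh : `|q r - q t| <= B * h by apply: (le_trans sp); rewrite ler_wpM2l//; lra.
have n0 := normr_ge0 (q r - q t).
have LL : L * `|q r - q t| <= L * B * h by rewrite -mulrA ler_wpM2l.
split; apply: le_trans LL.
  by apply: le_trans (LX _ _ rT tT) _; rewrite ler_wpM2r// lerDl (le_trans ler01).
by apply: le_trans (LY _ _ rT tT) _; rewrite ler_wpM2r// lerDr (le_trans ler01).
Qed.

(** Euler scheme for the pair (s, k) with the steps of tangent_step: Gronwall's
    discrete estimate keeps phi s (psi k (q 0)) close to q. While q stays away
    from 0, uniform attractivity of the two flows bounds s and k; since s + N k is
    at least the elapsed time, that time is bounded too. *)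
Lemma tracking M eps : 0 < eps -> exists2 Tm, 0 <= Tm & forall U T q,
  clock U -> 0 < T -> solves U X Y T q ->
  (forall s k, 0 <= s -> 0 <= k -> `|phi s (psi k (q 0))| <= M) ->
  (forall t, 0 <= t <= T -> 2 * eps <= `|q t|) ->
  T <= Tm /\ forall eta, 0 < eta -> exists s k, [/\ 0 <= s, 0 <= k &
    `|q T - phi s (psi k (q 0))| <= eta].
Proof.
move=> eps0.
have [r r0 rP] := flow_stable fX eps0.
have [S S0 SP] := flow_uniformly_attractive lX fX M eps0.
have [T0 T00 T0P] := flow_uniformly_attractive lY fY M r0.
have [N [C [h0 [N0 C0 h00 step]]]] := tangent_step cX cY cDX cDY det_neq0 lX lY qX qY fX fY M r0 S0.
exists (S + N * T0); first by rewrite addr_ge0// mulr_ge0.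
move=> U T q cU Tpos sq PM q2e; set p := q 0.
have pM k : 0 <= k -> `|psi k p| <= M.
  by move=> k0; have := PM 0 k (lexx 0) k0; rewrite (flow_start fX).
have p0M : `|p| <= M by have := pM 0 (lexx 0); rewrite (flow_start fY).
have small s k : 0 <= s -> 0 <= k -> eps <= `|phi s (psi k p)| ->
    [/\ s <= S, k <= T0 & forall t, 0 <= t <= s -> r <= `|phi t (psi k p)|].
  move=> s0 k0 big; split.
  - rewrite leNgt; apply/negP => Ss; move: big; rewrite leNgt => /negP; apply.
    by apply: SP; [exact: pM|exact: ltW].
  - rewrite leNgt; apply/negP => Tk; move: big; rewrite leNgt => /negP; apply.
    by apply: rP => //; apply: T0P => //; exact: ltW.
  - move=> t /andP[t0 ts]; rewrite leNgt; apply/negP => tr.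
    move: big; rewrite leNgt => /negP; apply.
    have -> : s = t + (s - t) by rewrite addrC subrK.
    by rewrite (flow_semigroup lX fX)// ?subr_ge0//; apply: rP => //; rewrite subr_ge0.
suff main eta : 0 < eta -> exists s k, [/\ 0 <= s, 0 <= k, T <= s + N * k &
    `|q T - phi s (psi k p)| <= Num.min eta eps].
  split.
    have [s [k [s0 k0 Tsk]]] := main 1 ltr01; rewrite le_min => /andP[_ near].
    have [|sS kT _] := small s k s0 k0.
      have := q2e T ltac:(by rewrite lexx ltW).
      have := ler_normD (q T - phi s (psi k p)) (phi s (psi k p)); rewrite subrK; lra.
    by have := ler_wpM2l N0 kT; lra.
  move=> eta eta0; have [s [k [s0 k0 _]]] := main eta eta0; rewrite le_min => /andP[near _].
  by exists s, k.
move=> eta0; set mu := Num.min eta eps.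
have mu0 : 0 < mu by rewrite lt_min eta0.
have [Cq Cq0 CqP] := solves_quadratic cU sq.
have [Mq qM] := solves_bounded sq.
have [L1 L11 LX] := lX (Num.max M Mq); have [L2 L21 LY] := lY (Num.max M Mq).
pose L := L1 + L2; have L0 : 0 <= L by rewrite addr_ge0// (le_trans ler01).
pose D := Cq + C; have D0 : 0 <= D by exact: addr_ge0.
pose E t := expR ((L + 1) * t).
have E0 t : 0 < E t by exact: expR_gt0.
(* The final error D * h * E T is at most mu for a fine enough subdivision. *)
have [n [n0 hh0 hmu]] : exists n, [/\ (0 < n)%N, T / n%:R <= h0 & D * (T / n%:R) * E T <= mu].
  pose x := T / h0 + D * E T * T / mu.
  have x0 : 0 <= D * E T * T / mu.
    by rewrite divr_ge0 ?(ltW mu0)// mulr_ge0 ?(ltW Tpos)// mulr_ge0 ?(ltW (E0 T)).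
  have x1 : 0 <= T / h0 by rewrite divr_ge0 ?(ltW Tpos)// ltW.
  pose n := (Num.bound x).+1.
  have xn : x <= n%:R.
    apply: (@le_trans _ _ (Num.bound x)%:R); last by rewrite ler_nat.
    by apply/ltW/archi_boundP; rewrite addr_ge0.
  have n0 : 0 < n%:R :> R by rewrite ltr0n.
  exists n; split => //.
    have : T / h0 <= n%:R by apply: le_trans xn; rewrite lerDl.
    by rewrite ler_pdivrMr// ler_pdivrMr// mulrC.
  have : D * E T * T / mu <= n%:R by apply: le_trans xn; rewrite lerDr.
  rewrite ler_pdivrMr// => H.
  rewrite (_ : _ * _ = D * E T * T / n%:R); last by rewrite mulrAC mulrA.
  by rewrite ler_pdivrMr// (mulrC mu).
pose h := T / n%:R.
have nR0 : 0 < n%:R :> R by rewrite ltr0n.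
have h_0 : 0 < h by rewrite divr_gt0.
have hn : h * n%:R = T by rewrite /h divfK// gt_eqF.
have main (j : nat) : (j <= n)%N -> exists s c, [/\ 0 <= s, 0 <= c, h * j%:R <= s + N * c &
    `|q (h * j%:R) - phi s (psi c p)| <= D * h * E (h * j%:R)].
  elim: j => [_|j IH jn].
    exists 0, 0; rewrite (flow_start fX) (flow_start fY) !mulr0 addr0; split=> //.
    by rewrite subrr normr0 !mulr_ge0// ltW.
  have [s [c [s0 c0 ksc err]]] := IH (ltnW jn).
  set t := h * j%:R in ksc err.
  have th : h * j.+1%:R = t + h by rewrite -natr1 mulrDr mulr1.
  have t0 : 0 <= t by rewrite mulr_ge0// ltW.
  have thT : t + h <= T by rewrite -th -hn ler_wpM2l ?(ltW h_0)// ler_nat.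
  have tT : t <= T by lra.
  set y := phi s (psi c p) in err *.
  have Et : E t <= E T by rewrite ler_expR ler_wpM2l// addr_ge0.
  have err_eps : `|q t - y| <= eps.
    apply: (le_trans err); apply: (@le_trans _ _ mu); last by rewrite ge_min lexx orbT.
    by apply: le_trans hmu; rewrite ler_wpM2l// mulr_ge0// ltW.
  have y_eps : eps <= `|y|.
    have := q2e t ltac:(by rewrite t0).
    have := ler_normD (q t - y) y; rewrite subrK; lra.
  have [sS kT0 yr] := small s c s0 c0 y_eps.
  pose dU := U (t + h) - U t.
  have dU01 : 0 <= dU <= h := clock_step cU t0 (ltW h_0).
  pose l := dU / h.
  have l01 : 0 <= l <= 1.
    by have /andP[u0 u1] := dU01; rewrite divr_ge0 ?(ltW h_0)//= ler_pdivrMr// mul1r.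
  have [| | |s' [k' [s'0 k'0 prog tan]]] := step (psi c p) s _ _ yr l h l01 _.
  - by rewrite s0.
  - by move=> u v u0 v0; rewrite -(flow_semigroup lY fY)//; apply: PM => //; exact: addr_ge0.
  - by rewrite (ltW h_0).
  exists s', (c + k'); split => //; first exact: addr_ge0.
    by rewrite th mulrDr; lra.
  rewrite th (flow_semigroup lY fY)//; set y' := phi s' _ in tan *.
  have qe := CqP t h t0 (ltW h_0) thT; rewrite -/dU in qe.
  have qtM : `|q t| <= Num.max M Mq by rewrite le_max qM ?orbT// t0.
  have yM : `|y| <= Num.max M Mq by rewrite le_max PM.
  have XL : `|X (q t) - X y| <= L * `|q t - y|.
    by apply: le_trans (LX _ _ qtM yM) _; rewrite ler_wpM2r// lerDl (le_trans ler01).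
  have YL : `|Y (q t) - Y y| <= L * `|q t - y|.
    by apply: le_trans (LY _ _ qtM yM) _; rewrite ler_wpM2r// lerDr (le_trans ler01).
  have mixL := norm_mix_le dU01 XL YL.
  have dUl : dU = h * l by rewrite /l mulrC divfK// gt_eqF.
  have -> : q (t + h) - y' =
    (q (t + h) - q t - dU *: X (q t) - (h - dU) *: Y (q t)) + (q t - y) +
    (dU *: (X (q t) - X y) + (h - dU) *: (Y (q t) - Y y)) -
    (y' - y - h *: (l *: X y + (1 - l) *: Y y)).
    by rewrite dUl; apply/rowP => i; rewrite !mxE; ring.
  apply: le_trans (ler_normB _ _) _.
  apply: le_trans (lerD (ler_normD _ _) (lexx _)) _.
  apply: le_trans (lerD (lerD (ler_normD _ _) (lexx _)) (lexx _)) _.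
  have Eh : E t * (1 + (L + 1) * h) <= E (t + h).
    by rewrite /E (mulrDr _ t h) expRD ler_wpM2l ?(ltW (E0 t))// expR_ge1Dx.
  have E1 : 1 <= E t by rewrite -expR0 ler_expR mulr_ge0// addr_ge0.
  have err1 : (1 + L * h) * `|q t - y| <= (1 + L * h) * (D * h * E t).
    by rewrite ler_wpM2l// addr_ge0// mulr_ge0// ltW.
  have Dh2 : 0 <= D * h ^+ 2 by rewrite mulr_ge0// exprn_ge0// ltW.
  have err2 := ler_wpM2l Dh2 E1.
  have err3 := ler_wpM2l (mulr_ge0 D0 (ltW h_0)) Eh.
  have Dh : Cq * h ^+ 2 + C * h ^+ 2 = D * h ^+ 2 by rewrite /D mulrDl.
  lra.
have [s [k [s0 k0 nsk err]]] := main n (leqnn n); rewrite hn in nsk err.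
by exists s, k; split => //; exact: le_trans err hmu.
Qed.
End Tracking.

(** * Stability of the switched system *)

Section Switched_stability.
Variable R : realType.
Notation V := 'rV[R]_2.
Implicit Types (t s d e h L K T B M a b r k l : R) (p w x y z v : V) (U u : R -> R) (q : R -> V).
Variables X Y : V -> V.
Hypotheses (cX : continuous X) (cY : continuous Y).
Hypotheses (cDX : forall i, continuous ('D_'e_i X)) (cDY : forall i, continuous ('D_'e_i Y)).
Hypothesis det_neq0 : forall y, y != 0 -> det2 (X y) (Y y) != 0.
Hypotheses (lX : locally_lipschitz X) (lY : locally_lipschitz Y).
Hypotheses (qX : quadratic_remainder X) (qY : quadratic_remainder Y).
Hypotheses (X0 : X 0 = 0) (Y0 : Y 0 = 0).
Variables phi psi : R -> V -> V.
Hypotheses (fX : stable_flow X phi) (fY : stable_flow Y psi).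

Lemma solves_from0 U T q : clock U -> solves U X Y T q -> q 0 = 0 ->
  forall t, 0 <= t <= T -> q t = 0.
Proof.
move=> cU sq q0.
apply: (solves_unique cU lX lY sq (_ : solves U X Y T (fun=> 0))) => //.
split; first by move=> t; exact: cvg_cst.
move=> t _ e e0; apply: filterS (nbhs_right_gt 0) => h h0.
by rewrite X0 Y0 !scaler0 !subr0 normr0 mulr_ge0// ltW.
Qed.

(** A solution that does not start at 0 stays away from 0 on [0, T], so it is
    tracked by points phi s (psi k (q 0)) with arbitrary precision. *)
Lemma orbit_bound U T q r : clock U -> 0 <= T -> solves U X Y T q ->
  (forall s k, 0 <= s -> 0 <= k -> `|phi s (psi k (q 0))| <= r) -> `|q T| <= r.
Proof.
move=> cU T0 sq rP.
have q0r : `|q 0| <= r by have := rP 0 0 (lexx 0) (lexx 0); rewrite (flow_start fX) (flow_start fY).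
have [q0|q0] := eqVneq (q 0) 0.
  by rewrite (solves_from0 cU sq q0) ?T0 ?lexx// normr0 (le_trans _ q0r).
move: T0; rewrite le_eqVlt => /predU1P[<-//|Tpos].
have [M qM] := solves_bounded sq.
have [L1 L11 LX] := lX M; have [L2' L21 LY] := lY M.
pose L := L1 + L2'; have L0 : 0 < L by rewrite addr_gt0// (lt_le_trans ltr01).
have M0 : `|0 : V| <= M by rewrite normr0 (le_trans (normr_ge0 (q 0)))// qM// lexx ltW.
have lower t : 0 <= t <= T -> `|q 0| <= `|q t| * expR (2 * L * t).
  move=> /andP[t0 tT]; apply: (solves_lower cU L0 t0 (solves_sub tT sq)) => s /andP[s0 st].
  have sM : `|q s| <= M by apply: qM; rewrite s0 (le_trans st).
  have := LX _ _ sM M0; have := LY _ _ sM M0; rewrite X0 Y0 !subr0 => h1 h2.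
  split; [apply: (le_trans h2)|apply: (le_trans h1)];
    by rewrite ler_wpM2r// ?lerDl ?lerDr (le_trans ler01).
pose eps := `|q 0| / expR (2 * L * T) / 2.
have eps0 : 0 < eps by rewrite !divr_gt0 ?expR_gt0// normr_gt0.
have [Tm _ track] := tracking cX cY cDX cDY det_neq0 lX lY qX qY fX fY r eps0.
have [|_ near] := track U T q cU Tpos sq rP.
  move=> t tT; have /andP[t0 tT'] := tT.
  rewrite /eps mulrC divfK// ler_pdivrMr ?expR_gt0//.
  have L2 : 0 <= 2 * L by rewrite mulr_ge0// ltW.
  by apply: (le_trans (lower t tT)); rewrite ler_wpM2l// ler_expR ler_wpM2l.
apply/ler_addgt0Pr => eta eta0; have [s [k [s0 k0 err]]] := near eta eta0.
have := ler_normD (q T - phi s (psi k (q 0))) (phi s (psi k (q 0))); rewrite subrK.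
have := rP s k s0 k0; lra.
Qed.

Lemma switched_stable e : 0 < e -> exists2 d, 0 < d & forall U T q, clock U -> 0 <= T ->
  solves U X Y T q -> `|q 0| < d -> `|q T| <= e.
Proof.
move=> e0; have [d1 d10 d1P] := flow_stable fX e0; have [d d0 dP] := flow_stable fY d10.
exists d => // U T q cU T0 sq qd; apply: (orbit_bound cU T0 sq) => s k s0 k0.
by apply/ltW/d1P => //; exact: dP.
Qed.

Lemma orbits_bounded M : exists2 B, 0 <= B & forall p s k, `|p| <= M -> 0 <= s -> 0 <= k ->
  `|phi s (psi k p)| <= B.
Proof.
have [B1 _ B1P] := flow_uniformly_bounded lY fY M.
have [B2 B20 B2P] := flow_uniformly_bounded lX fX B1.
by exists B2 => // p s k pM s0 k0; apply: B2P => //; exact: B1P.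
Qed.

Lemma switched_bounded M : exists2 B, 0 <= B & forall U T q, clock U -> 0 <= T ->
  solves U X Y T q -> `|q 0| <= M -> `|q T| <= B.
Proof.
have [B B0 BP] := orbits_bounded M; exists B => // U T q cU T0 sq qM.
by apply: (orbit_bound cU T0 sq) => s k s0 k0; exact: BP.
Qed.

(** The time spent away from the neighbourhood given by stability is bounded, and
    a solution that has entered that neighbourhood stays close to 0. *)
Lemma switched_attractive e M : 0 < e -> exists2 T, 0 < T & forall U q, clock U ->
  solves U X Y T q -> `|q 0| <= M -> `|q T| <= e.
Proof.
move=> e0; have [d d0 dP] := switched_stable e0.
have [B B0 BP] := orbits_bounded M.
have eps0 : 0 < d / 2 / 2 by rewrite !divr_gt0.
have [Tm Tm0 track] := tracking cX cY cDX cDY det_neq0 lX lY qX qY fX fY B eps0.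
have T0 : 0 < Tm + 1 by lra.
exists (Tm + 1) => // U q cU sq qM.
have [t [/andP[t0 tT] qt]] : exists t, 0 <= t <= Tm + 1 /\ `|q t| < d.
  apply: contrapT => no.
  have [] := track U _ q cU T0 sq (fun s k => BP (q 0) s k qM).
    move=> t tT; rewrite leNgt; apply/negP => qt; apply: no; exists t; split => //; lra.
  by rewrite gerDl ler10.
have Tt0 : 0 <= Tm + 1 - t by lra.
have sq' : solves U X Y (t + (Tm + 1 - t)) q by rewrite addrC subrK.
have := dP _ _ _ (clock_shift t0 cU) Tt0 (solves_shift t0 sq').
by rewrite addr0 [t + _]addrC subrK; apply.
Qed.

(** The solution for the fields projected on a large box is bounded a priori by
    the estimate for the original fields, as long as it is in the box; hence it
    never reaches the boundary of the box. *)
Lemma switched_global_solution p u : switching u ->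
  exists q, switched_solution X Y p u +oo%E q.
Proof.
move=> su; have [B B0 BP] := switched_bounded `|p|.
have B10 : 0 <= B + 1 by lra.
have [L1 [B1 [L11 XL XB]]] := clamped_global lX B10.
have [L2 [B2 [L21 YL YB]]] := clamped_global lY B10.
pose L := L1 + L2; pose BB := Num.max B1 B2.
have L1' : 1 <= L by rewrite (le_trans L11)// lerDl (le_trans ler01).
have XL' x y : `|X (clamp (B + 1) x) - X (clamp (B + 1) y)| <= L * `|x - y|.
  by apply: le_trans (XL x y) _; rewrite ler_wpM2r// lerDl (le_trans ler01).
have YL' x y : `|Y (clamp (B + 1) x) - Y (clamp (B + 1) y)| <= L * `|x - y|.
  by apply: le_trans (YL x y) _; rewrite ler_wpM2r// lerDr (le_trans ler01).
have XB' x : `|X (clamp (B + 1) x)| <= BB by rewrite le_max XB.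
have YB' x : `|Y (clamp (B + 1) x)| <= BB by rewrite le_max YB orbT.
have [q [qE cq]] := picard_fixpoint su L1' XL' YL' XB' YB' p.
have cXc := lipschitz_continuous (le_trans ler01 L1') XL'.
have cYc := lipschitz_continuous (le_trans ler01 L1') YL'.
have q0 : q 0 = p by rewrite qE// picard0.
have solves_c t : 0 <= t -> solves (mode_time u) (X \o clamp (B + 1)) (Y \o clamp (B + 1)) t q.
  move=> t0; split => // r /andP[r0 rt] e e0.
  have r0t : 0 <= r < t by rewrite rt ltW.
  apply: filterS2 (nbhs_right_gt 0) (picard_solves su cXc cYc p t0 (cq t) r0t e0) => h h0.
  by rewrite -!qE//; lra.
have qB t : 0 <= t -> `|q t| <= B.
  move=> t0; apply: (@continuation _ (fun t => `|q t|) t B (B + 1)) => //.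
  - exact: continuous_within_norm.
  - lra.
  - rewrite q0; have := BP (@id R) 0 (fun=> p); move=> /(_ (@clock_id R) (lexx 0)).
    apply => //; split; first by move=> ?; exact: cvg_cst.
    by move=> r /andP[r0 r0']; have := lt_trans r0 r0'; rewrite ltxx.
  - move=> s /andP[s0 st] near; apply: (BP (mode_time u) s q) => //.
    + exact: mode_time_clock.
    + apply: solves_congr (solves_c s s0) => r rs.
      by rewrite /= clamp_id// near.
    + by rewrite q0.
  by rewrite t0 lexx.
exists q; split => //.
  apply/within_cont_distP => t [t0 _] e e0.
  have /within_continuousP /(_ t) := cq (t + 1).
  move=> /(_ ltac:(rewrite t0/=; lra) e e0)[d d0 dP].
  exists (Num.min d 1); first by rewrite lt_min d0 ltr01.
  move=> s [s0 _]; rewrite lt_min => /andP[sd s1]; apply: dP => //.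
  by rewrite s0/=; have := ler_norm (s - t); lra.
move=> t [t0 _] i; rewrite [in LHS]qE// !mxE; congr (_ + _).
apply: eq_Rintegral => s; rewrite inE /= in_itv/= => /andP[s0 _].
have /clamp_id sB : `|q s| <= B + 1 by have := qB s s0; lra.
by rewrite /mix sB !mxE.
Qed.

(** The global solution is maximal, so max_solution is a maximal solution; it
    agrees with the global one by uniqueness, and its maximality makes its life
    span infinite. *)
Lemma max_solutionP p u : switching u ->
  life_span X Y p u = +oo%E /\ switched_solution X Y p u +oo%E (gamma X Y p u).
Proof.
move=> su; have [q sq] := switched_global_solution p su.
have mq : maximal (switched_solution X Y p u) +oo%E q.
  by split => // T' q' _ _; rewrite leey.
have mg : maximal (switched_solution X Y p u) (life_span X Y p u) (gamma X Y p u).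
  have := xgetPex (0%E, fun=> 0)
    (ex_intro (fun Tq => maximal (switched_solution X Y p u) Tq.1 Tq.2) (+oo%E, q) mq).
  exact.
have [sg maxg] := mg.
suff lo : life_span X Y p u = +oo%E by split => //; rewrite -lo.
apply/eqP; rewrite -leye_eq; apply: (maxg _ _ sq) => t [t0 tT].
have [g0 sgt] := switched_solution_solves cX cY su sg t0 tT.
have [q0 sqt] := switched_solution_solves cX cY su sq t0 (ltry t).
apply: (solves_unique (mode_time_clock su) lX lY sqt sgt); first by rewrite q0.
by rewrite t0 lexx.
Qed.

Lemma switched_GUAS : GUAS X Y.
Proof.
split=> [d d0|d1 d2 d10 d20].
  have d4 : 0 < d / 4 by rewrite divr_gt0.
  have [e e0 eP] := switched_stable d4; exists e => // p pe x [u su [t [t0 tT] <-]].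
  have [lo sg] := max_solutionP p su; rewrite lo in tT.
  have [g0 sgt] := switched_solution_solves cX cY su sg t0 (ltry t).
  apply: norm_eball; apply: (@le_lt_trans _ _ (d / 4)); last lra.
  by apply: (eP _ _ _ (mode_time_clock su) t0 sgt); rewrite g0; exact: eball_norm.
have d4 : 0 < d1 / 4 by rewrite divr_gt0.
have [T T0 TP] := switched_attractive d2 d4; exists T => // u p su pd.
have [lo sg] := max_solutionP p su; rewrite lo ltry; split => //.
have [g0 sgt] := switched_solution_solves cX cY su sg (ltW T0) (ltry T).
apply: norm_eball; apply: (@le_lt_trans _ _ (d1 / 4)); last lra.
by apply: (TP _ _ (mode_time_clock su) sgt); rewrite g0; apply/ltW/eball_norm.
Qed.
End Switched_stability.

Lemma det_col_mx (R : realType) (x y : 'rV[R]_2) :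
  \det (col_mx x y : 'M[R]_2) = det2 x y.
Proof.
have s0 : fintype.split (0 : 'I_(1 + 1)) = inl 0.
  by rewrite -[RHS]unsplitK; congr fintype.split; exact/val_inj.
have s1 : fintype.split (lift 0 0 : 'I_(1 + 1)) = inr 0.
  by rewrite -[RHS]unsplitK; congr fintype.split; exact/val_inj.
rewrite (expand_det_row _ 0) big_ord_recl big_ord1 /cofactor !det_mx11 /= !mxE /det2 s0 s1.
have -> : lift ord0 (0 : 'I_1) = 1 :> 'I_2 by exact/val_inj.
have -> : lift 1 (0 : 'I_1) = 0 :> 'I_2 by exact/val_inj.
by rewrite /= expr0 expr1 mul1r mulN1r mulrN.
Qed.

Theorem theorem6 (R : realType) (X Y : 'rV[R]_2 -> 'rV[R]_2)
    (smoothX : smooth X) (smoothY : smooth Y)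
    (X0 : X 0 = 0) (Y0 : Y 0 = 0)
    (gasX : vf_globally_asymptotically_stable X)
    (gasY : vf_globally_asymptotically_stable Y)
    (Z0 : collinearity_set X Y = [set 0]) :
  GUAS X Y.
Proof.
have cX : continuous X := (smoothX 0).1.
have cY : continuous Y := (smoothY 0).1.
have cDX i : continuous ('D_'e_i X) := ((smoothX 1).2 i).2.1.
have cDY i : continuous ('D_'e_i Y) := ((smoothY 1).2 i).2.1.
have lX := class_C1_lipschitz (smoothX 1); have lY := class_C1_lipschitz (smoothY 1).
have qX := class_C2_quadratic (smoothX 2); have qY := class_C2_quadratic (smoothY 2).
have [phi fX] := gas_stable_flow cX lX gasX.
have [psi fY] := gas_stable_flow cY lY gasY.
apply: (@switched_GUAS R X Y cX cY cDX cDY _ lX lY qX qY X0 Y0 phi psi fX fY) => y y0.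
apply: contra_neq y0 => yZ.
have : collinearity_set X Y y by rewrite /collinearity_set/= det_col_mx.
by rewrite Z0.
Qed.
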